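(* Let $(\mathcal N,\mathcal C,\mathcal C_{\mathcal N})$ be a recollement of abelian categories, with $\mathcal C$ skeletally small. Assume that $\mathcal C$ has enough projectives and enough injectives, and that $\mathcal N$ has a cotorsion pair $(\mathcal S,\mathcal V)$ with $\mathrm{Ext}^2_{\mathcal C}(\mathcal S,\mathcal V)=0$. Then the pair $((\mathcal S,\mathcal S^{\perp_1}),({}^{\perp_1}\mathcal V,\mathcal V))$ forms a generalized Hovey twin cotorsion pair (gHTCP) in $\mathcal C$, where $\mathcal S$ and $\mathcal V$ are regarded as subcategories of $\mathcal C$ and $\mathcal S^{\perp_1},{}^{\perp_1}\mathcal V$ are formed in $\mathcal C$. Moreover, with $\mathcal Z=\mathcal S^{\perp_1}\cap{}^{\perp_1}\mathcal V$ and $\mathcal I=\mathcal S\cap\mathcal V$, the canonical functor $\mathcal Z\subseteq\mathcal C\to\mathcal C_{\mathcal N}$ induces an equivalence $\mathcal Z/\mathcal I\simeq\mathcal C_{\mathcal N}$.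
   Context: **Recollement.** A recollement $(\mathcal N,\mathcal C,\mathcal C_{\mathcal N})$ of abelian categories consists of functors $\mathsf i:\mathcal N\to\mathcal C$, $\mathsf q,\mathsf p:\mathcal C\to\mathcal N$, $\mathsf e:\mathcal C\to\mathcal C_{\mathcal N}$, $\mathsf l,\mathsf r:\mathcal C_{\mathcal N}\to\mathcal C$ such that $(\mathsf q,\mathsf i,\mathsf p)$ and $(\mathsf l,\mathsf e,\mathsf r)$ are adjoint triples, $\mathsf i,\mathsf l,\mathsf r$ are fully faithful, and $\mathrm{Im}\,\mathsf i=\mathrm{Ker}\,\mathsf e$. $\mathcal N$ is regarded as a full subcategory of $\mathcal C$ via $\mathsf i$. The canonical functor $\mathcal C\to\mathcal C_{\mathcal N}$ is $\mathsf e$. **Conventions.** Subcategories are full, additive and closed under isomorphisms. $\mathcal M^{\perp_1}=\{X\in\mathcal C\mid\mathrm{Ext}^1_{\mathcal C}(M,X)=0\ \forall M\in\mathcal M\}$, ${}^{\perp_1}\mathcal M=\{X\in\mathcal C\mid\mathrm{Ext}^1_{\mathcal C}(X,M)=0\ \forall M\in\mathcal M\}$. The additive quotient $\mathcal C/\mathcal I$ has the same objects and morphisms modulo those factoring through an object of $\mathcal I$. **Cotorsion pair.** A cotorsion pair $(\mathcal S,\mathcal V)$ in an abelian category $\mathcal N$: subcategories closed under direct summands and extensions with $\mathrm{Ext}^1_{\mathcal N}(\mathcal S,\mathcal V)=0$ such that each $X\in\mathcal N$ has short exact sequences $0\to V\to S\to X\to0$ and $0\to X\to V'\to S'\to0$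 with $S,S'\in\mathcal S$, $V,V'\in\mathcal V$. **Left/right cotorsion pairs in an abelian category $\mathcal C$.** A morphism $p:U\to X$ with $U\in\mathcal U$ is a right $\mathcal U$-approximation if every morphism from an object of $\mathcal U$ to $X$ factors through $p$; left approximations are dual. A pair $(\mathcal U,\mathcal V)$ of subcategories closed under direct summands is a right cotorsion pair if (a) each $X\in\mathcal C$ has a short exact sequence $0\to V_X\to U_X\xrightarrow{p_X}X\to0$ with $V_X\in\mathcal V$ and $p_X$ a right $\mathcal U$-approximation; (b) each morphism $U\to V$ with $U\in\mathcal U$, $V\in\mathcal V$ factors through an object of $\mathcal U\cap\mathcal V$. A pair $(\mathcal S,\mathcal T)$ of subcategories closed under direct summands is a left cotorsion pair if (a) each $X$ has a short exact sequence $0\to X\xrightarrow{\iota_X}T^X\to S^X\to0$ with $S^X\in\mathcal S$ and $\iota_X$ a left $\mathcal T$-approximation; (b) each morphism $S\to T$ with $S\in\mathcal S$, $T\in\mathcal T$ factors through an object of $\mathcal S\cap\mathcal T$. **gHTCP.** $((\mathcal S,\mathcal T),(\mathcal U,\mathcal V))$, with $(\mathcal S,\mathcal T)$ a left and $(\mathcal U,\mathcal V)$ a right cotorsion pair, is a gHTCP if $\mathcal S\subseteq\mathcal U$, $\mathcal V\subseteq\mathcal T$, $\mathcal S\cap\mathcal T=\mathcal U\cap\mathcal V$, and, with $\mathcal I=\mathcal S\cap\mathcal V$, $\pi:\mathcal C\to\mathcal C/\mathcal I$, $R:\mathcal C/\mathcal I\to\mathcal U/\mathcal I$ ($X\mapsto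 U_X$) the right adjoint of $\mathcal U/\mathcal I\hookrightarrow\mathcal C/\mathcal I$ and $L:\mathcal C/\mathcal I\to\mathcal T/\mathcal I$ ($X\mapsto T^X$) the left adjoint of $\mathcal T/\mathcal I\hookrightarrow\mathcal C/\mathcal I$, there is a natural isomorphism $LR\pi\cong RL\pi$ of functors $\mathcal C\to\mathcal C/\mathcal I$. *)

(* Defs.v *)
From Stdlib Require Import Relations.Relation_Operators.
From HB Require Import structures.
From mathcomp Require Import all_boot all_algebra.
From mathcomp Require Import boolp.

Set Implicit Arguments.
Unset Strict Implicit.
Unset Printing Implicit Defensive.

Import GRing.Theory.

Local Open Scope quotient_scope.
Local Open Scope ring_scope.

Declare Scope cat_scope.
Delimit Scope cat_scope with cat.
Local Open Scope cat_scope.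

(* [zmodType] includes a choice operator on every hom-set; classically (boolp)
   this is no restriction. *)
Record category := Category {
  ob :> Type;
  hom : ob -> ob -> zmodType;
  idm : forall X, hom X X;
  comp : forall X Y Z, hom Y Z -> hom X Y -> hom X Z;
  comp1m : forall X Y (f : hom X Y), comp (idm Y) f = f;
  compm1 : forall X Y (f : hom X Y), comp f (idm X) = f;
  compA : forall X Y Z W (h : hom Z W) (g : hom Y Z) (f : hom X Y),
    comp h (comp g f) = comp (comp h g) f;
  compDl : forall X Y Z (g g' : hom Y Z) (f : hom X Y),
    comp (g + g') f = comp g f + comp g' f;
  compDr : forall X Y Z (g : hom Y Z) (f f' : hom X Y),
    comp g (f + f') = comp g f + comp g f' }.

Notation "g ∘ f" := (comp g f) (at level 40, left associativity) : cat_scope.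
Arguments idm {c} X.

(* Functors are not required to be additive: those of a recollement are
   automatically so, having an adjoint. *)
Record functor (C D : category) := Functor {
  fob :> C -> D;
  fmap : forall X Y, hom X Y -> hom (fob X) (fob Y);
  fmap1 : forall X, fmap (idm X) = idm (fob X);
  fmapM : forall X Y Z (g : hom Y Z) (f : hom X Y),
    fmap (g ∘ f) = fmap g ∘ fmap f }.
Arguments fmap {C D} _ {X Y}.

Definition id_functor (C : category) : functor C C :=
  @Functor C C (fun X => X) (fun _ _ f => f) (fun _ => erefl)
    (fun _ _ _ _ _ => erefl).

Section FunctorComposition.
Variables (C D E : category) (G : functor D E) (F : functor C D).

Lemma fcomp_map1 X : fmap G (fmap F (idm X)) = idm (G (F X)).
Proof. by rewrite !fmap1. Qed.

Lemma fcomp_mapM X Y Z (g : hom Y Z) (f : hom X Y) :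
  fmap G (fmap F (g ∘ f)) = fmap G (fmap F g) ∘ fmap G (fmap F f).
Proof. by rewrite !fmapM. Qed.

Definition fcomp : functor C E := Functor fcomp_map1 fcomp_mapM.

End FunctorComposition.

Notation "G ∘F F" := (fcomp G F) (at level 40, left associativity) : cat_scope.

Definition is_iso (C : category) (X Y : C) (f : hom X Y) : Prop :=
  exists g : hom Y X, g ∘ f = idm X /\ f ∘ g = idm Y.

Definition isomorphic (C : category) (X Y : C) : Prop :=
  exists f : hom X Y, is_iso f.

Definition nat_isomorphic (C D : category) (F G : functor C D) : Prop :=
  exists t : forall X, hom (F X) (G X),
    (forall X Y (f : hom X Y), t Y ∘ fmap F f = fmap G f ∘ t X) /\
    (forall X, is_iso (t X)).

Definition is_equivalence (C D : category) (F : functor C D) : Prop :=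
  exists G : functor D C,
    nat_isomorphic (G ∘F F) (id_functor C) /\
    nat_isomorphic (F ∘F G) (id_functor D).

Definition fully_faithful (C D : category) (F : functor C D) : Prop :=
  forall X Y, bijective (@fmap C D F X Y).

(* [F] is left adjoint to [G]. *)
Record adjunction (C D : category) (F : functor C D) (G : functor D C) := {
  adj_unit : forall X, hom X (G (F X));
  adj_counit : forall Y, hom (F (G Y)) Y;
  adj_unit_nat : forall X X' (f : hom X X'),
    adj_unit X' ∘ f = fmap G (fmap F f) ∘ adj_unit X;
  adj_counit_nat : forall Y Y' (g : hom Y Y'),
    adj_counit Y' ∘ fmap F (fmap G g) = g ∘ adj_counit Y;
  adj_triangleL : forall X, adj_counit (F X) ∘ fmap F (adj_unit X) = idm (F X);
  adj_triangleR : forall Y, fmap G (adj_counit Y) ∘ adj_unit (G Y) = idm (G Y) }.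

(* The index type lives in the universe of the hom-sets; no constraint relates
   it to the universe of the objects. *)
Definition skeletally_small (C : category) : Prop :=
  exists (K : Type@{Algebra.Zmodule.axioms_.u0}) (F : K -> C),
    forall X : C, exists k, isomorphic X (F k).

Definition mono (C : category) (X Y : C) (f : hom X Y) : Prop :=
  forall W (g h : hom W X), f ∘ g = f ∘ h -> g = h.

Definition epi (C : category) (X Y : C) (f : hom X Y) : Prop :=
  forall Z (g h : hom Y Z), g ∘ f = h ∘ f -> g = h.

Definition is_kernel (C : category) (K X Y : C) (k : hom K X) (f : hom X Y) :
    Prop :=
  f ∘ k = 0 /\ forall W (g : hom W X), f ∘ g = 0 -> exists! u, k ∘ u = g.

Definition is_cokernel (C : category) (X Y Q : C) (c : hom Y Q) (f : hom X Y) :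
    Prop :=
  c ∘ f = 0 /\ forall Z (g : hom Y Z), g ∘ f = 0 -> exists! u, u ∘ c = g.

(* Initial and terminal. *)
Definition zero_object (C : category) (Z : C) : Prop :=
  forall X, (forall f : hom X Z, f = 0) /\ (forall f : hom Z X, f = 0).

Definition biproduct (C : category) (A B P : C) : Prop :=
  exists (i1 : hom A P) (i2 : hom B P) (p1 : hom P A) (p2 : hom P B),
    [/\ p1 ∘ i1 = idm A, p2 ∘ i2 = idm B, p1 ∘ i2 = 0, p2 ∘ i1 = 0 &
        i1 ∘ p1 + i2 ∘ p2 = idm P].

Record abelian (C : category) : Prop := {
  abelian_zero : exists Z : C, zero_object Z;
  abelian_biproduct : forall A B : C, exists P, biproduct A B P;
  abelian_kernel : forall (X Y : C) (f : hom X Y),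
    exists (K : C) (k : hom K X), is_kernel k f;
  abelian_cokernel : forall (X Y : C) (f : hom X Y),
    exists (Q : C) (c : hom Y Q), is_cokernel c f;
  abelian_mono : forall (X Y : C) (f : hom X Y),
    mono f -> exists (Z : C) (g : hom Y Z), is_kernel f g;
  abelian_epi : forall (X Y : C) (f : hom X Y),
    epi f -> exists (W : C) (g : hom W X), is_cokernel f g }.

Definition short_exact (C : category) (A B D : C) (f : hom A B) (g : hom B D) :
    Prop :=
  is_kernel f g /\ is_cokernel g f.

Definition projective (C : category) (P : C) : Prop :=
  forall (X Y : C) (g : hom X Y) (f : hom P Y), epi g -> exists h, g ∘ h = f.

Definition injective_object (C : category) (J : C) : Prop :=
  forall (X Y : C) (g : hom X Y) (f : hom X J), mono g -> exists h, h ∘ g = f.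

Definition enough_projectives (C : category) : Prop :=
  forall X : C, exists (P : C) (p : hom P X), projective P /\ epi p.

Definition enough_injectives (C : category) : Prop :=
  forall X : C, exists (J : C) (j : hom X J), injective_object J /\ mono j.

Record extension (C : category) (A B : C) := Extension {
  ext_mid : C;
  ext_inj : hom B ext_mid;
  ext_sur : hom ext_mid A;
  ext_exact : short_exact ext_inj ext_sur }.

(* [yext n A B] is the type of exact sequences
     0 -> B -> E_n -> ... -> E_0 -> A -> 0
   with n+1 middle terms, presented by their decomposition into short exact
   sequences: the leftmost one, 0 -> B -> E_n -> K -> 0, spliced to a sequence
   from K to A. *)
Fixpoint yext (C : category) (n : nat) (A B : C) : Type :=
  match n with
  | 0 => extension A B
  | m.+1 => {K : C & (extension K B * yext m A K)%type}
  end.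

(* There is a morphism of exact sequences given by [b] on the left end and by
   the identity of [A] on the right end; [k] is the map induced on the image
   at which the sequences are spliced. *)
Fixpoint yext_mor (C : category) (n : nat) (A B B' : C) (b : hom B B') :
    yext n A B -> yext n A B' -> Prop :=
  match n return yext n A B -> yext n A B' -> Prop with
  | 0 => fun e e' => exists t : hom (ext_mid e) (ext_mid e'),
      t ∘ ext_inj e = ext_inj e' ∘ b /\ ext_sur e' ∘ t = ext_sur e
  | m.+1 => fun e e' =>
      let: existT K (x, y) := e in let: existT K' (x', y') := e' in
      exists (t : hom (ext_mid x) (ext_mid x')) (k : hom K K'),
        [/\ t ∘ ext_inj x = ext_inj x' ∘ b, ext_sur x' ∘ t = k ∘ ext_sur x &
            yext_mor k y y']
  end.

Definition yoneda_equiv (C : category) (n : nat) (A B : C) :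
    yext n A B -> yext n A B -> Prop :=
  clos_refl_sym_trans (yext n A B) (yext_mor (idm B)).

(* Ext^n(A, B) = 0. For n > 0, Ext^n(A, B) is the group of (n-fold) extensions
   modulo Yoneda equivalence, so it vanishes iff it has only one element. *)
Definition Ext_zero (C : category) (n : nat) (A B : C) : Prop :=
  match n with
  | 0 => forall f : hom A B, f = 0
  | m.+1 => forall e e' : yext m A B, yoneda_equiv e e'
  end.

Definition meet_subcat (C : category) (P Q : C -> Prop) : C -> Prop :=
  fun X => P X /\ Q X.

Definition sub_subcat (C : category) (P Q : C -> Prop) : Prop :=
  forall X, P X -> Q X.

Record additive_subcat (C : category) (P : C -> Prop) : Prop := {
  subcat_iso : forall X Y : C, isomorphic X Y -> P X -> P Y;
  subcat_zero : exists2 Z : C, zero_object Z & P Z;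
  subcat_biproduct : forall A B : C, P A -> P B ->
    exists2 X : C, biproduct A B X & P X }.

Definition summand_closed (C : category) (P : C -> Prop) : Prop :=
  forall A B X : C, biproduct A B X -> P X -> P A.

Definition extension_closed (C : category) (P : C -> Prop) : Prop :=
  forall (A B D : C) (f : hom A B) (g : hom B D),
    short_exact f g -> P A -> P D -> P B.

Definition factors_through (C : category) (P : C -> Prop) (X Y : C)
    (f : hom X Y) : Prop :=
  exists (Z : C) (a : hom X Z) (b : hom Z Y), P Z /\ f = b ∘ a.

Section CompTheory.
Variable C : category.

Lemma comp0m (X Y Z : C) (f : hom X Y) : (0 : hom Y Z) ∘ f = 0.
Proof. by apply: (addIr (0 ∘ f)); rewrite -compDl !add0r. Qed.

Lemma compm0 (X Y Z : C) (g : hom Y Z) : g ∘ (0 : hom X Y) = 0.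
Proof. by apply: (addIr (g ∘ 0)); rewrite -compDr !add0r. Qed.

Lemma compNm (X Y Z : C) (g : hom Y Z) (f : hom X Y) : (- g) ∘ f = - (g ∘ f).
Proof. by apply: (addIr (g ∘ f)); rewrite -compDl !addNr comp0m. Qed.

Lemma compmN (X Y Z : C) (g : hom Y Z) (f : hom X Y) : g ∘ (- f) = - (g ∘ f).
Proof. by apply: (addIr (g ∘ f)); rewrite -compDr !addNr compm0. Qed.

Lemma compBl (X Y Z : C) (g g' : hom Y Z) (f : hom X Y) :
  (g - g') ∘ f = g ∘ f - g' ∘ f.
Proof. by rewrite compDl compNm. Qed.

Lemma compBr (X Y Z : C) (g : hom Y Z) (f f' : hom X Y) :
  g ∘ (f - f') = g ∘ f - g ∘ f'.
Proof. by rewrite compDr compmN. Qed.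

End CompTheory.

Lemma biproduct_iso (C : category) (A B P A' B' Q : C) :
  isomorphic A A' -> isomorphic B B' ->
  biproduct A B P -> biproduct A' B' Q -> isomorphic P Q.
Proof.
move=> [f [f' [f'f ff']]] [g [g' [g'g gg']]].
move=> [i1 [i2 [p1 [p2 [e11 e22 e12 e21 e]]]]].
move=> [j1 [j2 [q1 [q2 [d11 d22 d12 d21 d]]]]].
exists (j1 ∘ (f ∘ p1) + j2 ∘ (g ∘ p2)), (i1 ∘ (f' ∘ q1) + i2 ∘ (g' ∘ q2)).
have cancel5 (X1 X2 X3 X4 X5 X6 : C) (a : hom X5 X6) (b : hom X4 X5)
    (c : hom X3 X4) (c' : hom X2 X3) (b' : hom X1 X2) :
  (a ∘ (b ∘ c)) ∘ (c' ∘ b') = a ∘ (b ∘ ((c ∘ c') ∘ b')) by rewrite !compA.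
split; rewrite compDl !compDr !cancel5 ?d11 ?d22 ?d12 ?d21 ?e11 ?e22 ?e12 ?e21.
  rewrite !comp0m !compm0 addr0 add0r !comp1m !(compA f') !(compA g').
  by rewrite f'f g'g !comp1m.
rewrite !comp0m !compm0 addr0 add0r !comp1m !(compA f) !(compA g).
by rewrite ff' gg' !comp1m.
Qed.

Lemma isomorphic_refl (C : category) (X : C) : isomorphic X X.
Proof. by exists (idm X), (idm X); rewrite comp1m. Qed.

Lemma zero_object_iso (C : category) (X Y : C) :
  zero_object X -> zero_object Y -> isomorphic X Y.
Proof.
move=> X0 Y0; exists 0, 0; rewrite !comp0m.
by split; apply/esym; [apply: (X0 X).1 | apply: (Y0 Y).1].
Qed.

Lemma additive_subcatI (C : category) (P Q : C -> Prop) :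
  additive_subcat P -> additive_subcat Q -> additive_subcat (meet_subcat P Q).
Proof.
move=> hP hQ; split.
- move=> X Y XY [PX QX].
  by split; [apply: (subcat_iso hP) PX | apply: (subcat_iso hQ) QX].
- have [[Z Z0 PZ] [Z' Z'0 QZ']] := (subcat_zero hP, subcat_zero hQ).
  exists Z => //; split=> //.
  exact: (subcat_iso hQ (zero_object_iso Z'0 Z0)) QZ'.
- move=> A B [PA QA] [PB QB].
  have [X ABX PX] := subcat_biproduct hP PA PB.
  have [Y ABY QY] := subcat_biproduct hQ QA QB.
  exists X => //; split=> //; apply: (subcat_iso hQ) QY.
  by apply: biproduct_iso ABY ABX; apply: isomorphic_refl.
Qed.

Section Quotient.
Variables (C : category) (I : C -> Prop) (addI : additive_subcat I).

Definition ideal of additive_subcat I := fun X Y : C =>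
  [pred f : hom X Y | `[< factors_through I f >]].

Lemma ideal_zmod_closed (X Y : C) : zmod_closed (ideal addI X Y).
Proof.
split=> [|f g].
  have [Z _ IZ] := subcat_zero addI.
  by apply/asboolP; exists Z, 0, 0; rewrite comp0m.
move=> /asboolP[A [a [b [IA ->]]]] /asboolP[B [c [d [IB ->]]]].
have [P [i1 [i2 [p1 [p2 [e11 e22 e12 e21 _]]]]] IP] :=
  subcat_biproduct addI IA IB.
apply/asboolP; exists P, (i1 ∘ a + i2 ∘ c), (b ∘ p1 - d ∘ p2); split=> //.
rewrite compDr !compBl !compA -!(compA b) -!(compA d) e11 e12 e21 e22.
by rewrite !comp0m !compm0 !comp1m subr0 sub0r.
Qed.

HB.instance Definition _ (X Y : C) :=
  GRing.isZmodClosed.Build (hom X Y) (ideal addI X Y) (ideal_zmod_closed X Y).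

Lemma ideal_compl (X Y Z : C) (g : hom Y Z) (f : hom X Y) :
  f \in ideal addI X Y -> g ∘ f \in ideal addI X Z.
Proof.
move=> /asboolP[A [a [b [IA ->]]]]; apply/asboolP.
by exists A, a, (g ∘ b); rewrite compA.
Qed.

Lemma ideal_compr (X Y Z : C) (g : hom Y Z) (f : hom X Y) :
  g \in ideal addI Y Z -> g ∘ f \in ideal addI X Z.
Proof.
move=> /asboolP[A [a [b [IA ->]]]]; apply/asboolP.
by exists A, (a ∘ f), b; rewrite compA.
Qed.

Definition quot_hom (X Y : C) : zmodType := Quotient.quot (ideal addI X Y).

Definition quot_pi (X Y : C) (f : hom X Y) : quot_hom X Y :=
  \pi_(Quotient.quot (ideal addI X Y)) f.

Definition quot_repr (X Y : C) (f : quot_hom X Y) : hom X Y := repr f.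

Lemma quot_reprK (X Y : C) (f : quot_hom X Y) : quot_pi (quot_repr f) = f.
Proof. exact: reprK. Qed.

Lemma quot_piE (X Y : C) (f g : hom X Y) :
  quot_pi f = quot_pi g <-> factors_through I (f - g).
Proof.
rewrite /quot_pi; split=> [/eqP|fg].
  by rewrite -Quotient.idealrBE => /asboolP.
by apply/eqP; rewrite -Quotient.idealrBE; apply/asboolP.
Qed.

Lemma quot_piD (X Y : C) (f g : hom X Y) :
  quot_pi (f + g) = quot_pi f + quot_pi g.
Proof. by rewrite /quot_pi !piE. Qed.

Definition quot_comp (X Y Z : C) (g : quot_hom Y Z) (f : quot_hom X Y) :
  quot_hom X Z := quot_pi (quot_repr g ∘ quot_repr f).

Lemma quot_piM (X Y Z : C) (g : hom Y Z) (f : hom X Y) :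
  quot_pi (g ∘ f) = quot_comp (quot_pi g) (quot_pi f).
Proof.
set g' := quot_repr (quot_pi g); set f' := quot_repr (quot_pi f).
have /quot_piE/asboolP gg' : quot_pi g = quot_pi g' by rewrite quot_reprK.
have /quot_piE/asboolP ff' : quot_pi f = quot_pi f' by rewrite quot_reprK.
apply/quot_piE/asboolP; rewrite -/f' -/g'.
have -> : g ∘ f - g' ∘ f' = (g - g') ∘ f + g' ∘ (f - f').
  by rewrite compBl compBr addrA subrK.
exact: (rpredD (ideal_compr f gg') (ideal_compl g' ff')).
Qed.

Lemma quot_comp1m (X Y : C) (f : quot_hom X Y) :
  quot_comp (quot_pi (idm Y)) f = f.
Proof. by rewrite -(quot_reprK f) -quot_piM comp1m. Qed.

Lemma quot_compm1 (X Y : C) (f : quot_hom X Y) :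
  quot_comp f (quot_pi (idm X)) = f.
Proof. by rewrite -(quot_reprK f) -quot_piM compm1. Qed.

Lemma quot_compA (X Y Z W : C) (h : quot_hom Z W) (g : quot_hom Y Z)
    (f : quot_hom X Y) :
  quot_comp h (quot_comp g f) = quot_comp (quot_comp h g) f.
Proof.
by rewrite -(quot_reprK f) -(quot_reprK g) -(quot_reprK h) -!quot_piM compA.
Qed.

Lemma quot_compDl (X Y Z : C) (g g' : quot_hom Y Z) (f : quot_hom X Y) :
  quot_comp (g + g') f = quot_comp g f + quot_comp g' f.
Proof.
rewrite -(quot_reprK f) -(quot_reprK g) -(quot_reprK g').
by rewrite -quot_piD -!quot_piM compDl quot_piD.
Qed.

Lemma quot_compDr (X Y Z : C) (g : quot_hom Y Z) (f f' : quot_hom X Y) :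
  quot_comp g (f + f') = quot_comp g f + quot_comp g f'.
Proof.
rewrite -(quot_reprK f) -(quot_reprK g) -(quot_reprK f').
by rewrite -quot_piD -!quot_piM compDr quot_piD.
Qed.

Definition quot_cat : category :=
  Category quot_comp1m quot_compm1 quot_compA quot_compDl quot_compDr.

Definition quot_functor : functor C quot_cat :=
  @Functor C quot_cat (fun X => X) quot_pi (fun _ => erefl) quot_piM.

Section Lift.
Variables (D : category) (F : functor C D).
Hypothesis F_quot : forall (X Y : C) (f g : hom X Y),
  factors_through I (f - g) -> fmap F f = fmap F g.

Lemma quot_lift_pi (X Y : C) (f : hom X Y) :
  fmap F (quot_repr (quot_pi f)) = fmap F f.
Proof. by apply/F_quot/quot_piE; rewrite quot_reprK. Qed.

Lemma quot_lift1 (X : quot_cat) : fmap F (quot_repr (idm X)) = idm (F X).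
Proof. by rewrite quot_lift_pi fmap1. Qed.

Lemma quot_liftM (X Y Z : quot_cat) (g : hom Y Z) (f : hom X Y) :
  fmap F (quot_repr (g ∘ f)) = fmap F (quot_repr g) ∘ fmap F (quot_repr f).
Proof. by rewrite quot_lift_pi fmapM. Qed.

Definition quot_lift : functor quot_cat D :=
  @Functor quot_cat D F _ quot_lift1 quot_liftM.

End Lift.
End Quotient.

Definition full_subcat (C : category) (P : C -> Prop) : category :=
  @Category {X : C | P X} (fun X Y => hom (sval X) (sval Y))
    (fun X => idm (sval X)) (fun X Y Z g f => g ∘ f)
    (fun _ _ => @comp1m C _ _) (fun _ _ => @compm1 C _ _)
    (fun _ _ _ _ => @compA C _ _ _ _)
    (fun _ _ _ => @compDl C _ _ _) (fun _ _ _ => @compDr C _ _ _).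

Definition inclusion (C : category) (P : C -> Prop) : functor (full_subcat P) C :=
  @Functor (full_subcat P) C sval (fun _ _ f => f) (fun _ => erefl)
    (fun _ _ _ _ _ => erefl).

Record recollement (N C CN : category) := {
  rec_i : functor N C;
  rec_q : functor C N;
  rec_p : functor C N;
  rec_e : functor C CN;
  rec_l : functor CN C;
  rec_r : functor CN C;
  rec_adj_qi : adjunction rec_q rec_i;
  rec_adj_ip : adjunction rec_i rec_p;
  rec_adj_le : adjunction rec_l rec_e;
  rec_adj_er : adjunction rec_e rec_r;
  rec_ff_i : fully_faithful rec_i;
  rec_ff_l : fully_faithful rec_l;
  rec_ff_r : fully_faithful rec_r;
  rec_im_ker : forall X : C,
    (exists A : N, isomorphic X (rec_i A)) <-> zero_object (rec_e X) }.

(* [P] regarded as a subcategory of [D]: its closure under isomorphism. *)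
Definition ess_image (C D : category) (F : functor C D) (P : C -> Prop) : D -> Prop :=
  fun X => exists2 A, P A & isomorphic X (F A).

Definition right_perp1 (C : category) (M : C -> Prop) : C -> Prop :=
  fun X => forall A, M A -> Ext_zero 1 A X.

Definition left_perp1 (C : category) (M : C -> Prop) : C -> Prop :=
  fun X => forall A, M A -> Ext_zero 1 X A.

Record cotorsion_pair (N : category) (S V : N -> Prop) : Prop := {
  cotorsion_subcatl : additive_subcat S;
  cotorsion_subcatr : additive_subcat V;
  cotorsion_summandl : summand_closed S;
  cotorsion_summandr : summand_closed V;
  cotorsion_extl : extension_closed S;
  cotorsion_extr : extension_closed V;
  cotorsion_Ext1 : forall A B, S A -> V B -> Ext_zero 1 A B;
  cotorsion_resl : forall X : N,
    exists (V0 S0 : N) (k : hom V0 S0) (p : hom S0 X),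
      [/\ V V0, S S0 & short_exact k p];
  cotorsion_resr : forall X : N,
    exists (V0 S0 : N) (j : hom X V0) (c : hom V0 S0),
      [/\ V V0, S S0 & short_exact j c] }.

Definition right_approx (C : category) (U : C -> Prop) (U0 X : C) (p : hom U0 X) :
    Prop :=
  U U0 /\ forall (U' : C) (f : hom U' X), U U' -> exists g, p ∘ g = f.

Definition left_approx (C : category) (T : C -> Prop) (X T0 : C) (j : hom X T0) :
    Prop :=
  T T0 /\ forall (T' : C) (f : hom X T'), T T' -> exists g, g ∘ j = f.

(* [p : U0 -> X] is a possible choice of p_X : U_X -> X. *)
Definition right_cotorsion_approx (C : category) (U V : C -> Prop) (U0 X : C)
    (p : hom U0 X) : Prop :=
  right_approx U p /\
  exists (V0 : C) (k : hom V0 U0), V V0 /\ short_exact k p.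

(* [j : X -> T0] is a possible choice of iota_X : X -> T^X. *)
Definition left_cotorsion_approx (C : category) (S T : C -> Prop) (X T0 : C)
    (j : hom X T0) : Prop :=
  left_approx T j /\
  exists (S0 : C) (c : hom T0 S0), S S0 /\ short_exact j c.

Record right_cotorsion_pair (C : category) (U V : C -> Prop) : Prop := {
  rcp_subcatl : additive_subcat U;
  rcp_subcatr : additive_subcat V;
  rcp_summandl : summand_closed U;
  rcp_summandr : summand_closed V;
  rcp_approx : forall X : C,
    exists (U0 : C) (p : hom U0 X), right_cotorsion_approx U V p;
  rcp_factor : forall (X Y : C) (f : hom X Y),
    U X -> V Y -> factors_through (meet_subcat U V) f }.

Record left_cotorsion_pair (C : category) (S T : C -> Prop) : Prop := {
  lcp_subcatl : additive_subcat S;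
  lcp_subcatr : additive_subcat T;
  lcp_summandl : summand_closed S;
  lcp_summandr : summand_closed T;
  lcp_approx : forall X : C,
    exists (T0 : C) (j : hom X T0), left_cotorsion_approx S T j;
  lcp_factor : forall (X Y : C) (f : hom X Y),
    S X -> T Y -> factors_through (meet_subcat S T) f }.

(* In a gHTCP, I = S ∩ V is contained in U and in T, so U/I and T/I are the
   full subcategories of C/I on the objects of U and of T. *)
Definition LR_commute (C : category) (S T U V : C -> Prop)
    (addI : additive_subcat (meet_subcat S V)) : Prop :=
  let Q := quot_cat addI in
  let pi := quot_functor addI in
  let incU := @inclusion Q U in
  let incT := @inclusion Q T in
  exists (R : functor Q (full_subcat (U : Q -> Prop))) (adjR : adjunction incU R)
         (L : functor Q (full_subcat (T : Q -> Prop))) (adjL : adjunction L incT),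
    [/\ (* R X = U_X, the counit being the class of p_X *)
        forall X : C, exists p : hom (sval (R X) : C) X,
          right_cotorsion_approx U V p /\ adj_counit adjR X = fmap pi p,
        (* L X = T^X, the unit being the class of iota_X *)
        forall X : C, exists j : hom X (sval (L X) : C),
          left_cotorsion_approx S T j /\ adj_unit adjL X = fmap pi j &
        nat_isomorphic (incT ∘F L ∘F incU ∘F R ∘F pi)
                       (incU ∘F R ∘F incT ∘F L ∘F pi)].

Record gHTCP (C : category) (S T U V : C -> Prop) : Prop := {
  gHTCP_left : left_cotorsion_pair S T;
  gHTCP_right : right_cotorsion_pair U V;
  gHTCP_subl : sub_subcat S U;
  gHTCP_subr : sub_subcat V T;
  gHTCP_capE : forall X, meet_subcat S T X <-> meet_subcat U V X;
  gHTCP_LR : LR_commute T U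
    (additive_subcatI (lcp_subcatl gHTCP_left) (rcp_subcatr gHTCP_right)) }.

Definition gHTCP_ideal (C : category) (S T U V : C -> Prop)
    (h : gHTCP S T U V) : additive_subcat (meet_subcat S V) :=
  additive_subcatI (lcp_subcatl (gHTCP_left h)) (rcp_subcatr (gHTCP_right h)).

(* [F : C -> D] induces an equivalence Z/I -> D, where Z/I is the full
   subcategory of C/I on the objects of Z (I being contained in Z). *)
Definition induces_equivalence (C D : category) (F : functor C D) (Z I : C -> Prop)
    (addI : additive_subcat I) : Prop :=
  exists F_quot : forall (X Y : C) (f g : hom X Y),
      factors_through I (f - g) -> fmap F f = fmap F g,
    is_equivalence
      (quot_lift addI F_quot ∘F inclusion (Z : quot_cat addI -> Prop)).

(* Main.v *)
From Stdlib Require Import Relations.Relation_Operators.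
From mathcomp Require Import all_boot all_algebra.
From mathcomp Require Import boolp.
Require Import Defs.

(** Identify [N] with its essential image, the kernel of [e], and [S] and [V]
    with subcategories of [C]. Write T for the right orthogonal of [S]
    and U for the left orthogonal of [V] in [C]. Since [i] and [e] have adjoints on both
    sides they are exact, so [N] is a Serre subcategory and ([S], [V]) is a
    cotorsion pair relative to [N] (ess_image_relative_cotorsion_pair).

    The approximations of an object X exist because of enough injectives: the
    kernel E of J -> K -> r e K, where K is the cokernel of an embedding of X
    into an injective J, is orthogonal to all of [N], and E/X is in [N]
    (envelope_exists). Resolving E/X by [S] and [V] inside [N] gives a special
    preenvelope of X (special_preenvelope). Projectives give the dual
    statement. Approximations become universal arrows modulo the ideal of
    [S] meet [V], which yields the adjoints L and R.

    Everything else rests on one consequence of Ext^2(S, V) = 0: an epi with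
    kernel in [V] followed by a mono with cokernel in [S] can be rewritten in the
    opposite order (Ext2_zero_swap). Applied to U_X -> X -> T^X, it produces an
    object that is at once an L-reflection of U_X and an R-coreflection of T^X,
    whence LR = RL (nat_isomorphic_LR). Applied to the image factorization of
    a map a inverted by [e], after correcting its kernel and cokernel inside
    [N], it writes a as a mono with cokernel in [S] followed by an epi with
    kernel in [V] (localization_factorization). Objects of T see such monos as
    isomorphisms up to the ideal, and objects of U see such epis so.
    With a the counit l e X -> X this gives fullness of [e] on the
    intersection of T and U; faithfulness modulo the ideal and essential
    surjectivity come from the image factorization and from special
    preenvelopes of the objects l Y. *)

Set Implicit Arguments.
Unset Strict Implicit.
Unset Printing Implicit Defensive.

Import GRing.Theory.
Local Open Scope ring_scope.
Local Open Scope cat_scope.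

(** * Opposite categories and monomorphisms *)

(** Every notion below is self-dual or comes with its dual, and an unfolded
    statement about [op C] is convertible to the dual statement about [C]; so
    each argument is made once and transferred by instantiation. *)
Definition op (C : category) : category :=
  @Category C (fun X Y => hom Y X) (fun X => idm X) (fun _ _ _ g f => f ∘ g)
    (fun _ _ f => compm1 f) (fun _ _ f => comp1m f)
    (fun _ _ _ _ h g f => esym (compA f g h))
    (fun _ _ _ g g' f => compDr f g g') (fun _ _ _ g f f' => compDl f f' g).

Section Basics.
Variable C : category.
Implicit Types X Y Z W A B D K P Q : C.

Lemma monoP X Y (f : hom X Y) :
  mono f <-> forall W (g : hom W X), f ∘ g = 0 -> g = 0.
Proof.
split=> [mf W g fg0|f0 W g h fgh]; first by apply: mf; rewrite fg0 compm0.
by apply/eqP; rewrite -subr_eq0; apply/eqP/f0; rewrite compBr fgh subrr.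
Qed.

Lemma kernel_mono K X Y (k : hom K X) (f : hom X Y) : is_kernel k f -> mono k.
Proof.
move=> [fk ker]; apply/monoP => W g kg0.
have [u [_ uniq]] := ker W 0 (compm0 _ _).
by rewrite -(uniq g) // (uniq 0) // compm0.
Qed.

Lemma mono_kernel K X Y (k : hom K X) (f : hom X Y) : mono k -> f ∘ k = 0 ->
  (forall W (g : hom W X), f ∘ g = 0 -> exists u, k ∘ u = g) -> is_kernel k f.
Proof.
move=> mk fk0 ker; split=> // W g /ker[u ug]; exists u; split=> // v vg.
by apply: mk; rewrite ug vg.
Qed.

Lemma kernel_lift K X Y (k : hom K X) (f : hom X Y) W (g : hom W X) :
  is_kernel k f -> f ∘ g = 0 -> exists u, k ∘ u = g.
Proof. by move=> [_ ker] /ker[u [ug _]]; exists u. Qed.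

Lemma mono_comp X Y Z (g : hom Y Z) (f : hom X Y) :
  mono g -> mono f -> mono (g ∘ f).
Proof. by move=> mg mf W u v; rewrite -!compA => /mg/mf. Qed.

Lemma mono_compr X Y Z (g : hom Y Z) (f : hom X Y) : mono (g ∘ f) -> mono f.
Proof. by move=> mgf W u v e; apply: mgf; rewrite -!compA e. Qed.

Lemma zero_objectP X : zero_object X <-> idm X = 0.
Proof.
split=> [/(_ X)[] // ->//|id0 Y].
by split=> f; rewrite -[LHS](comp1m, compm1) ?id0 ?comp0m //
  -[LHS]compm1 id0 compm0.
Qed.

End Basics.

Section BasicsDual.
Variable C : category.
Implicit Types X Y Z W A B D K P Q : C.

Lemma epiP X Y (f : hom X Y) :
  epi f <-> forall W (g : hom Y W), g ∘ f = 0 -> g = 0.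
Proof. exact: (@monoP (op C) Y X f). Qed.

Lemma cokernel_epi X Y Q (c : hom Y Q) (f : hom X Y) : is_cokernel c f -> epi c.
Proof. exact: (@kernel_mono (op C) Q Y X c f). Qed.

Lemma epi_cokernel X Y Q (c : hom Y Q) (f : hom X Y) : epi c -> c ∘ f = 0 ->
  (forall W (g : hom Y W), g ∘ f = 0 -> exists u, u ∘ c = g) -> is_cokernel c f.
Proof. exact: (@mono_kernel (op C) Q Y X c f). Qed.

Lemma cokernel_lift X Y Q (c : hom Y Q) (f : hom X Y) W (g : hom Y W) :
  is_cokernel c f -> g ∘ f = 0 -> exists u, u ∘ c = g.
Proof. exact: (@kernel_lift (op C) Q Y X c f W g). Qed.

Lemma epi_comp X Y Z (g : hom Y Z) (f : hom X Y) : epi g -> epi f -> epi (g ∘ f).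
Proof. by move=> mg mf; apply: (@mono_comp (op C) Z Y X f g). Qed.

Lemma epi_compl X Y Z (g : hom Y Z) (f : hom X Y) : epi (g ∘ f) -> epi g.
Proof. exact: (@mono_compr (op C) Z Y X f g). Qed.

Lemma short_exact_op A B D (f : hom A B) (g : hom B D) :
  @short_exact (op C) D B A g f <-> short_exact f g.
Proof. by split; case. Qed.

Lemma biproduct_op A B P : biproduct A B P -> @biproduct (op C) A B P.
Proof.
move=> [i1 [i2 [p1 [p2 [e11 e22 e12 e21 e]]]]].
by exists p1, p2, i1, i2.
Qed.

End BasicsDual.

Lemma abelian_op (C : category) : abelian C -> abelian (op C).
Proof.
case=> z b k c m e; split.
- by have [Z Z0] := z; exists Z => X; have [? ?] := Z0 X.
- by move=> A B; have [P /biproduct_op] := b A B; exists P.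
- by move=> X Y f; apply: (c Y X f).
- by move=> X Y f; apply: (k Y X f).
- by move=> X Y f; apply: (e Y X f).
- by move=> X Y f; apply: (m Y X f).
Qed.

(** * Pullbacks in an abelian category *)

Definition is_pullback (C : category) (X Y Z P : C) (p1 : hom P X)
    (p2 : hom P Y) (f : hom X Z) (g : hom Y Z) : Prop :=
  f ∘ p1 = g ∘ p2 /\ forall W (u : hom W X) (v : hom W Y), f ∘ u = g ∘ v ->
    exists! w, p1 ∘ w = u /\ p2 ∘ w = v.

Section Pullback.
Variable C : category.
Implicit Types X Y Z W A B D K P Q : C.

Lemma is_pullbackC X Y Z P (p1 : hom P X) (p2 : hom P Y) (f : hom X Z)
    (g : hom Y Z) : is_pullback p1 p2 f g -> is_pullback p2 p1 g f.
Proof.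
move=> [e univ]; split=> // W u v /esym/univ[w [[e1 e2] uniq]].
by exists w; split=> // w' [? ?]; apply: uniq.
Qed.

Lemma pullback_lift X Y Z P (p1 : hom P X) (p2 : hom P Y) (f : hom X Z)
    (g : hom Y Z) W (u : hom W X) (v : hom W Y) :
  is_pullback p1 p2 f g -> f ∘ u = g ∘ v ->
  exists w, p1 ∘ w = u /\ p2 ∘ w = v.
Proof. by move=> [_ univ] /univ[w [? _]]; exists w. Qed.

Lemma pullback_inj X Y Z P (p1 : hom P X) (p2 : hom P Y) (f : hom X Z)
    (g : hom Y Z) W (u v : hom W P) :
  is_pullback p1 p2 f g -> p1 ∘ u = p1 ∘ v -> p2 ∘ u = p2 ∘ v -> u = v.
Proof.
move=> [e univ] e1 e2.
have [|w [_ uniq]] := univ W (p1 ∘ u) (p2 ∘ u); first by rewrite !compA e.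
by rewrite -(uniq u) // (uniq v).
Qed.

Lemma pullback_kernel X Y Z P K (p1 : hom P X) (p2 : hom P Y) (f : hom X Z)
    (g : hom Y Z) (k : hom K X) : is_pullback p1 p2 f g -> is_kernel k f ->
  exists2 k', is_kernel k' p2 & p1 ∘ k' = k.
Proof.
move=> pb kf; have [|k' [k'1 k'2]] := pullback_lift pb (u := k) (v := 0).
  by rewrite kf.1 compm0.
exists k' => //; apply: mono_kernel => //.
  by apply: (@mono_compr _ _ _ _ p1); rewrite k'1; apply: kernel_mono kf.
move=> W w p2w0; have [|u ku] := kernel_lift (g := p1 ∘ w) kf.
  by rewrite compA pb.1 -compA p2w0 compm0.
exists u; apply: (pullback_inj pb); rewrite compA; first by rewrite k'1.
by rewrite k'2 comp0m p2w0.
Qed.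

Hypothesis abC : abelian C.

(** The pullback is the kernel of [f q1 - g q2] on a biproduct. This map is epi
    because [f] is, hence it is the cokernel of the pullback; that is what
    makes the projection [p2] epi. *)
Lemma pullback_exists X Y Z (f : hom X Z) (g : hom Y Z) : epi f ->
  exists P (p1 : hom P X) (p2 : hom P Y), is_pullback p1 p2 f g /\ epi p2.
Proof.
move=> ef.
have [B [i1 [i2 [q1 [q2 [e11 e22 e12 e21 e]]]]]] := abelian_biproduct abC X Y.
set d := f ∘ q1 - g ∘ q2.
have d1 : d ∘ i1 = f.
  by rewrite compBl -!compA e11 e21 compm1 compm0 subr0.
have d2 : d ∘ i2 = - g.
  by rewrite compBl -!compA e12 e22 compm1 compm0 sub0r.
have [P [k kd]] := abelian_kernel abC d.
exists P, (q1 ∘ k), (q2 ∘ k); split; first split.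
- by apply/eqP; rewrite -subr_eq0 !compA -compBl; apply/eqP/kd.1.
- move=> W u v uv.
  have [|w kw] := kernel_lift (g := i1 ∘ u + i2 ∘ v) kd.
    by rewrite compDr !compA d1 d2 compNm uv subrr.
  exists w; split.
    rewrite -!compA kw !compDr !compA e11 e12 e21 e22.
    by rewrite !comp0m !comp1m addr0 add0r.
  move=> w' [e1 e2]; apply: (kernel_mono kd); rewrite kw -e1 -e2.
  by rewrite !compA -!compDl e comp1m.
- have ed : epi d by apply: (@epi_compl _ _ _ _ d i1); rewrite d1.
  have [W [h dh]] := abelian_epi abC ed.
  apply/epiP => U z zq.
  have [w' kw'] := kernel_lift (g := h) kd dh.1.
  have [|w wd] := cokernel_lift (g := z ∘ q2) dh.
    by rewrite -kw' !compA -(compA z) zq comp0m.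
  have w0 : w = 0.
    move/epiP: ef; apply.
    by rewrite -d1 compA wd -compA e21 compm0.
  by rewrite -(compm1 z) -e22 compA -wd w0 !comp0m.
Qed.

Lemma epi_short_exact A B D (f : hom A B) (g : hom B D) :
  epi g -> is_kernel f g -> short_exact f g.
Proof.
move=> eg kf; split=> //; apply: epi_cokernel => //; first exact: kf.1.
move=> W u uf0; have [U [h gh]] := abelian_epi abC eg.
have [v fv] := kernel_lift kf gh.1.
by apply: (cokernel_lift gh); rewrite -fv compA uf0 comp0m.
Qed.

Lemma epi_kernel_exists B D (g : hom B D) : epi g ->
  exists A (f : hom A B), short_exact f g.
Proof.
move=> eg; have [A [f fg]] := abelian_kernel abC g.
by exists A, f; apply: epi_short_exact.
Qed.

Lemma short_exact_pullback A B D D' (f : hom A B) (g : hom B D) (h : hom D' D) :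
  short_exact f g -> exists P (f' : hom A P) (g' : hom P D') (h' : hom P B),
    [/\ short_exact f' g', h' ∘ f' = f & is_pullback h' g' g h].
Proof.
move=> [kf cg].
have [P [h' [g' [pb eg']]]] := pullback_exists h (cokernel_epi cg).
have [f' kf' e] := pullback_kernel pb kf.
by exists P, f', g', h'; split=> //; apply: epi_short_exact.
Qed.

End Pullback.

(** * Operations on short exact sequences *)

Section ExactSequences.
Variable C : category.
Hypothesis abC : abelian C.
Implicit Types X Y Z W A B D E K P Q : C.

Lemma pullback_epi X Y Z P (p1 : hom P X) (p2 : hom P Y) (f : hom X Z)
    (g : hom Y Z) : is_pullback p1 p2 f g -> epi f -> epi p2.
Proof.
move=> pb ef; have [P' [q1 [q2 [pb' eq2]]]] := pullback_exists abC g ef.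
have [w [_ wq]] := pullback_lift pb pb'.1.
by apply: (@epi_compl _ _ _ _ p2 w); rewrite wq.
Qed.

Lemma short_exact_pullback_epi A B A' B' D (f : hom A B) (g : hom B D)
    (f' : hom A' B') (g' : hom B' D) : short_exact f g -> short_exact f' g' ->
  exists P (k : hom A P) (p' : hom P B') (k' : hom A' P) (p : hom P B),
    [/\ short_exact k p', short_exact k' p, p ∘ k = f, p' ∘ k' = f' &
        g ∘ p = g' ∘ p'].
Proof.
move=> fg fg'.
have [P [k [p' [p [kp' e pb]]]]] := short_exact_pullback abC g' fg.
have [k' kk' e'] := pullback_kernel (is_pullbackC pb) fg'.1.
exists P, k, p', k', p; split=> //; last exact: pb.1.
apply: epi_short_exact => //; apply: pullback_epi (is_pullbackC pb) _.
exact: cokernel_epi fg'.2.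
Qed.

(** The kernel of a composite of two epis is an extension of the two
    kernels. *)
Lemma short_exact_preimage A B D A' D' (f : hom A B) (g : hom B D)
    (f' : hom A' D) (g' : hom D D') : short_exact f g -> short_exact f' g' ->
  exists P (k : hom A P) (p : hom P A') (h : hom P B),
    [/\ short_exact k p, short_exact h (g' ∘ g), h ∘ k = f & g ∘ h = f' ∘ p].
Proof.
move=> fg fg'.
have [P [k [p [h [kp e pb]]]]] := short_exact_pullback abC f' fg.
exists P, k, p, h; split=> //; last exact: pb.1.
apply: epi_short_exact => //.
  by apply: epi_comp; [exact: cokernel_epi fg'.2|exact: cokernel_epi fg.2].
apply: mono_kernel.
- move=> W u v huv; apply: (pullback_inj pb) => //.
  by apply: (kernel_mono fg'.1); rewrite !compA -pb.1 -!compA huv.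
- by rewrite -compA pb.1 compA fg'.1.1 comp0m.
- move=> W w; rewrite -compA => /(kernel_lift fg'.1)[v fv].
  have [u [hu _]] := pullback_lift pb (esym fv).
  by exists u.
Qed.

(** Given [u] and [v] that agree in [D'], the map [u] lifts to [B] along the
    epi [q] obtained by pulling [g] back along [u]; after correcting the lift
    by a map into [A] it is compatible with [v] and descends along [q]. *)
Lemma short_exact_mor_pullback A B D B' D' (f : hom A B) (g : hom B D)
    (f' : hom A B') (g' : hom B' D') (t : hom B B') (k : hom D D') :
  short_exact f g -> short_exact f' g' -> t ∘ f = f' -> g' ∘ t = k ∘ g ->
  is_pullback g t k g'.
Proof.
move=> fg fg' tf gt; split=> // W u v kugv.
(* [g] and [t] are jointly mono, as [t] is mono on the kernel of [g]. *)
have mono_pair X (w : hom X B) : g ∘ w = 0 -> t ∘ w = 0 -> w = 0.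
  move=> /(kernel_lift fg.1)[d <-]; rewrite compA tf => fd0.
  by have /monoP mf := kernel_mono fg'.1; rewrite (mf _ _ fd0) compm0.
have [P [x [q [w [xq _ pb]]]]] := short_exact_pullback abC u fg.
have [c fc] : exists c, f' ∘ c = t ∘ w - v ∘ q.
  apply: (kernel_lift fg'.1).
  by rewrite compBr !compA gt -kugv -!compA pb.1 subrr.
pose w' := w - f ∘ c.
have gw' : g ∘ w' = u ∘ q by rewrite compBr compA fg.1.1 comp0m subr0 pb.1.
have tw' : t ∘ w' = v ∘ q by rewrite compBr compA tf fc subKr.
have [|z zq] := cokernel_lift (g := w') xq.2.
  apply: mono_pair; rewrite compA ?gw' ?tw' -compA xq.1.1 compm0 //.
have qe := cokernel_epi xq.2.
exists z; split; first by split; apply: qe; rewrite -compA zq.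
move=> z' [gz' tz']; apply/eqP; rewrite -subr_eq0; apply/eqP/mono_pair.
  by rewrite compBr gz'; apply: qe; rewrite compBl -compA zq gw' subrr comp0m.
by rewrite compBr tz'; apply: qe; rewrite compBl -compA zq tw' subrr comp0m.
Qed.

End ExactSequences.

Section ExactSequencesDual.
Variable C : category.
Hypothesis abC : abelian C.
Implicit Types X Y Z W A B D E K P Q : C.

Lemma mono_short_exact A B D (f : hom A B) (g : hom B D) :
  mono f -> is_cokernel g f -> short_exact f g.
Proof.
move=> mf cg.
exact/short_exact_op/(@epi_short_exact _ (abelian_op abC) D B A g f mf cg).
Qed.

Lemma mono_cokernel_exists A B (f : hom A B) : mono f ->
  exists D (g : hom B D), short_exact f g.
Proof.
move=> /(@epi_kernel_exists _ (abelian_op abC) B A f)[D [g [fg gf]]].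
by exists D, g.
Qed.

Lemma short_exact_pushout A B D A' (f : hom A B) (g : hom B D) (h : hom A A') :
  short_exact f g -> exists P (f' : hom A' P) (g' : hom P D) (h' : hom B P),
    [/\ short_exact f' g', g' ∘ h' = g & h' ∘ f = f' ∘ h].
Proof.
move=> /short_exact_op.
move=> /(@short_exact_pullback _ (abelian_op abC) _ _ _ _ _ _ h).
move=> [P [g' [f' [h' [/short_exact_op fg e [e' _]]]]]].
by exists P, f', g', h'; split; [exact: fg|exact: e|exact: e'].
Qed.

Lemma short_exact_pushout_mono A B D B' D' (f : hom A B) (g : hom B D)
    (f' : hom A B') (g' : hom B' D') : short_exact f g -> short_exact f' g' ->
  exists P (i' : hom B' P) (p : hom P D) (i : hom B P) (p' : hom P D'),
    [/\ short_exact i' p, short_exact i p', p ∘ i = g, p' ∘ i' = g' &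
        i ∘ f = i' ∘ f'].
Proof.
move=> fg fg'.
have [P [p [i' [p' [i [/short_exact_op ip /short_exact_op ip' e1 e2 e3]]]]]] :=
  @short_exact_pullback_epi (op C) (abelian_op abC) _ _ _ _ _ _ _ _ _
    (proj2 (short_exact_op _ _) fg) (proj2 (short_exact_op _ _) fg').
exists P, i', p, i, p'.
by split; [exact: ip|exact: ip'|exact: e1|exact: e2|exact: e3].
Qed.

Lemma short_exact_quotient A B D A' D' (f : hom A B) (g : hom B D)
    (f' : hom A' A) (g' : hom A D') : short_exact f g -> short_exact f' g' ->
  exists P (k : hom D' P) (p : hom P D) (h : hom B P),
    [/\ short_exact k p, short_exact (f ∘ f') h, p ∘ h = g & h ∘ f = k ∘ g'].
Proof.
move=> fg fg'.
have [P [p [k [h [/short_exact_op kp /short_exact_op fh e e']]]]] :=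
  @short_exact_preimage (op C) (abelian_op abC) _ _ _ _ _ _ _ _ _
    (proj2 (short_exact_op _ _) fg) (proj2 (short_exact_op _ _) fg').
by exists P, k, p, h; split; [exact: kp|exact: fh|exact: e|exact: e'].
Qed.

End ExactSequencesDual.

(** * Vanishing of Ext^1 *)

Section Splitting.
Variable C : category.
Implicit Types X Y Z W A B D E K P Q : C.

Lemma section_retraction A B D (f : hom A B) (g : hom B D) (s : hom D B) :
  short_exact f g -> g ∘ s = idm D ->
  exists r, r ∘ f = idm A /\ f ∘ r + s ∘ g = idm B.
Proof.
move=> [kf _] gs; have [|r fr] := kernel_lift (g := idm B - s ∘ g) kf.
  by rewrite compBr compA gs compm1 comp1m subrr.
exists r; split; last by rewrite fr subrK.
apply: (kernel_mono kf); rewrite compA fr compBl comp1m compm1 -compA kf.1.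
by rewrite compm0 subr0.
Qed.

Lemma split_short_exact A B P (i1 : hom A P) (i2 : hom B P) (p1 : hom P A)
    (p2 : hom P B) : p1 ∘ i1 = idm A -> p2 ∘ i2 = idm B -> p2 ∘ i1 = 0 ->
  i1 ∘ p1 + i2 ∘ p2 = idm P -> short_exact i1 p2.
Proof.
move=> e11 e22 e21 e; split.
  apply: mono_kernel => // [W u v /(congr1 (comp p1))|W w p2w].
    by rewrite !compA e11 !comp1m.
  by exists (p1 ∘ w); rewrite -[RHS]comp1m -e compDl -!compA p2w !compm0 addr0.
apply: epi_cokernel => // [W u v /(congr1 (fun x => x ∘ i2))|W w wi1].
  by rewrite -!compA e22 !compm1.
by exists (w ∘ i2); rewrite -[RHS]compm1 -e compDr !compA wi1 !comp0m add0r.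
Qed.

End Splitting.

Section RetractionSection.
Variable C : category.
Implicit Types X Y Z W A B D E K P Q : C.

Lemma retraction_section A B D (f : hom A B) (g : hom B D) (r : hom B A) :
  short_exact f g -> r ∘ f = idm A ->
  exists s, g ∘ s = idm D /\ f ∘ r + s ∘ g = idm B.
Proof.
move=> fg rf; have [s [gs e]] :=
  @section_retraction (op C) _ _ _ g f r (proj2 (short_exact_op _ _) fg) rf.
by exists s; split; [exact: gs|rewrite addrC; exact: e].
Qed.

Definition splits A B (e : extension A B) : Prop :=
  exists s, ext_sur e ∘ s = idm A.

(** Going back along a morphism of extensions, a section cannot be pulled back
    directly, but the associated retraction can be precomposed. *)
Lemma yext_mor_splits A B (e e' : yext 0 A B) :
  yext_mor (idm B) e e' -> splits e <-> splits e'.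
Proof.
move=> [t [tf gt]]; split=> [[s es]|[s es]].
  by exists (t ∘ s); rewrite compA gt.
have [r [rf _]] := section_retraction (ext_exact e') es.
have [|s' [es' _]] := retraction_section (r := r ∘ t) (ext_exact e).
  by rewrite -compA tf compm1.
by exists s'.
Qed.

Lemma yoneda_equiv_splits A B (e e' : yext 0 A B) :
  yoneda_equiv e e' -> splits e <-> splits e'.
Proof.
elim=> {e e'} [e e' /yext_mor_splits|e|e e' _ ->|e e' e'' _ -> _ ->] //.
Qed.

Hypothesis abC : abelian C.

Lemma splitting_extension A B : exists e : extension A B, splits e /\
  forall e', splits e' -> @yext_mor C 0 A B B (idm B) e e'.
Proof.
have [P [i1 [i2 [p1 [p2 [e11 e22 e12 e21 e]]]]]] := abelian_biproduct abC B A.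
exists (Extension (split_short_exact e11 e22 e21 e)); split.
  by exists i2.
move=> e' [s es]; exists (ext_inj e' ∘ p1 + s ∘ p2) => /=; split.
  by rewrite compDl -!compA e11 e21 compm0 addr0.
by rewrite compDr !compA (ext_exact e').1.1 es comp0m comp1m add0r.
Qed.

(** Splitting is invariant under Yoneda equivalence, and every split extension
    receives a morphism from the biproduct. *)
Lemma Ext1_zeroP A B : Ext_zero 1 A B <->
  forall E (f : hom B E) (g : hom E A), short_exact f g ->
    exists s, g ∘ s = idm A.
Proof.
have [e0 [e0s e0m]] := splitting_extension A B; split=> [ext0 E f g fg|spl].
  exact/(yoneda_equiv_splits (ext0 e0 (Extension fg))).
have e0e (e : yext 0 A B) : @yoneda_equiv C 0 A B e0 e.
  by apply/rst_step/e0m; have [s es] := spl _ _ _ (ext_exact e); exists s.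
by move=> e e'; apply: rst_trans (e0e e'); exact: rst_sym (e0e e).
Qed.

End RetractionSection.

Section Ext1.
Variable C : category.
Hypothesis abC : abelian C.
Implicit Types X Y Z W A B D E K P Q : C.

Lemma Ext1_zero_retraction A B : Ext_zero 1 A B <->
  forall E (f : hom B E) (g : hom E A), short_exact f g ->
    exists r, r ∘ f = idm B.
Proof.
rewrite (Ext1_zeroP abC); split=> spl E f g fg; have [s es] := spl E f g fg.
  by have [r [rf _]] := section_retraction fg es; exists r.
by have [r [rf _]] := retraction_section fg es; exists r.
Qed.

Lemma Ext1_zero_op A B : @Ext_zero (op C) 1 B A <-> Ext_zero 1 A B.
Proof.
rewrite Ext1_zero_retraction (Ext1_zeroP (abelian_op abC)).
split=> spl E f g /short_exact_op/spl[r rf]; exists r; exact: rf.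
Qed.

Lemma Ext1_zero_lift A B : Ext_zero 1 A B <->
  forall E D (f : hom B E) (g : hom E D) (h : hom A D), short_exact f g ->
    exists h', g ∘ h' = h.
Proof.
rewrite (Ext1_zeroP abC); split=> [spl E D f g h fg|lft E f g fg].
  have [P [f' [g' [h' [fg' _ [e _]]]]]] := short_exact_pullback abC h fg.
  have [s gs] := spl _ _ _ fg'.
  by exists (h' ∘ s); rewrite compA e -compA gs compm1.
exact: lft fg.
Qed.

Lemma Ext1_zero_extend A B : Ext_zero 1 A B <->
  forall D E (f : hom D E) (g : hom E A) (h : hom D B), short_exact f g ->
    exists h', h' ∘ f = h.
Proof.
rewrite Ext1_zero_retraction; split=> [spl D E f g h fg|ext E f g fg].
  have [P [f' [g' [h' [fg' _ e]]]]] := short_exact_pushout abC h fg.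
  have [r rf] := spl _ _ _ fg'.
  by exists (r ∘ h'); rewrite -compA e compA rf comp1m.
exact: ext fg.
Qed.

Lemma Ext1_zero_retractr A B B' (i : hom B B') (r : hom B' B) :
  r ∘ i = idm B -> Ext_zero 1 A B' -> Ext_zero 1 A B.
Proof.
move=> ri /Ext1_zero_extend ext; apply/Ext1_zero_retraction => E f g fg.
have [h hf] := ext _ _ _ _ i fg.
by exists (r ∘ h); rewrite -compA hf.
Qed.

(** Exactness of Ext^1(A, -) in the middle, for [E] an extension of [A] by [B]: the
    quotient of [E] by [B'] splits, and the section lifts to [E]. *)
Lemma Ext1_zero_middler A B B' B'' (f : hom B' B) (g : hom B B'') :
  short_exact f g -> Ext_zero 1 A B' -> Ext_zero 1 A B'' -> Ext_zero 1 A B.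
Proof.
move=> fg /Ext1_zero_lift lft /(Ext1_zeroP abC) spl.
apply/(Ext1_zeroP abC) => E b c bc.
have [P [k [p [h [kp fh ph hf]]]]] := short_exact_quotient abC bc fg.
have [s ps] := spl _ _ _ kp.
have [s' hs'] := lft _ _ _ _ s fh.
by exists s'; rewrite -ph -compA hs'.
Qed.

Lemma Ext1_zero_zeror A B : zero_object B -> Ext_zero 1 A B.
Proof.
move=> /zero_objectP B0; apply/Ext1_zero_retraction => E f g fg.
by exists 0; rewrite comp0m.
Qed.

End Ext1.

Section Perp.
Variable C : category.
Hypothesis abC : abelian C.

Lemma right_perp1_ext (M : C -> Prop) : extension_closed (right_perp1 M).
Proof.
move=> A B D f g fg pA pD X MX.
by apply: (Ext1_zero_middler abC fg); [apply: pA|apply: pD].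
Qed.

Lemma right_perp1_summand (M : C -> Prop) : summand_closed (right_perp1 M).
Proof.
move=> A B X [i1 [i2 [p1 [p2 [e11 _ _ _ _]]]]] pX Y MY.
by apply: (Ext1_zero_retractr abC e11); apply: pX.
Qed.

Lemma right_perp1_additive (M : C -> Prop) : additive_subcat (right_perp1 M).
Proof.
split=> [X Y [f [g [gf fg]]] pX A MA||A B pA pB].
- by apply: (Ext1_zero_retractr abC fg); apply: pX.
- have [Z Z0] := abelian_zero abC; exists Z => // A MA.
  exact: Ext1_zero_zeror.
- have [P bP] := abelian_biproduct abC A B; exists P => //.
  have [i1 [i2 [p1 [p2 [e11 e22 e12 e21 e]]]]] := bP.
  exact: right_perp1_ext (split_short_exact e11 e22 e21 e) pA pB.
Qed.

End Perp.

(** * Vanishing of Ext^2 *)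

Definition is_pushout (C : category) (X Y Z P : C) (i1 : hom X P)
    (i2 : hom Y P) (f : hom Z X) (g : hom Z Y) : Prop :=
  i1 ∘ f = i2 ∘ g /\ forall W (u : hom X W) (v : hom Y W), u ∘ f = v ∘ g ->
    exists! w, w ∘ i1 = u /\ w ∘ i2 = v.

Section Ext2.
Variable C : category.
Hypothesis abC : abelian C.
Implicit Types X Y Z W A B D E K P Q : C.

Lemma short_exact_mor_pushout A B D A' B' (f : hom A B) (g : hom B D)
    (f' : hom A' B') (g' : hom B' D) (t : hom B B') (k : hom A A') :
  short_exact f g -> short_exact f' g' -> g' ∘ t = g -> t ∘ f = f' ∘ k ->
  is_pushout f' t k f.
Proof.
move=> /short_exact_op fg /short_exact_op fg'.
exact: (@short_exact_mor_pullback (op C) (abelian_op abC) _ _ _ _ _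
  g' f' g f t k fg' fg).
Qed.

Lemma pushout_desc X Y Z P (i1 : hom X P)
    (i2 : hom Y P) (f : hom Z X) (g : hom Z Y) W (u : hom X W) (v : hom Y W) :
  is_pushout i1 i2 f g -> u ∘ f = v ∘ g -> exists w, w ∘ i1 = u /\ w ∘ i2 = v.
Proof. by move=> [_ univ] /univ[w [? _]]; exists w. Qed.

Lemma pushout_inj X Y Z P (i1 : hom X P)
    (i2 : hom Y P) (f : hom Z X) (g : hom Z Y) W (u v : hom P W) :
  is_pushout i1 i2 f g -> u ∘ i1 = v ∘ i1 -> u ∘ i2 = v ∘ i2 -> u = v.
Proof. exact: (@pullback_inj (op C) X Y Z P i1 i2 f g W u v). Qed.

Section Syzygy.
Variables (A B P O : C) (k : hom O P) (p : hom P A).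
Hypothesis (projP : projective P) (kp : short_exact k p).

(** The class of [e] in Ext^2(A, B) is sent by dimension shifting to the class
    in Ext^1(O, B) of the pullback of [x] along the map [O -> K] induced by
    [u]; this predicate says that the latter class vanishes. *)
Definition syzygy_lifts (e : yext 1 A B) : Prop :=
  let: existT K (x, y) := e in
  forall u : hom P (ext_mid y), ext_sur y ∘ u = p ->
    exists w, ext_inj y ∘ (ext_sur x ∘ w) = u ∘ k.

(** Independence of the choice of [u]: two choices differ by a map from the
    projective [P] to [K], which lifts to the middle of [x]. *)
Lemma syzygy_lifts1 K (x : extension K B) (y : extension A K)
    (u : hom P (ext_mid y)) w : ext_sur y ∘ u = p ->
  ext_inj y ∘ (ext_sur x ∘ w) = u ∘ k -> syzygy_lifts (existT _ K (x, y)).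
Proof.
move=> yu xw u' yu'.
have [|d yd] := kernel_lift (g := u' - u) (ext_exact y).1.
  by rewrite compBr yu yu' subrr.
have [d' xd'] := projP d (cokernel_epi (ext_exact x).2).
exists (w + d' ∘ k).
by rewrite !compDr xw !compA -(compA (ext_inj y)) xd' yd compBl addrC subrK.
Qed.

Lemma yext_mor_syzygy (e e' : yext 1 A B) :
  yext_mor (idm B) e e' -> syzygy_lifts e <-> syzygy_lifts e'.
Proof.
move: e e' => [K [x y]] [K' [x' y']] /= [t [h [tx xt [s [sy ys]]]]].
have [u yu] := projP p (cokernel_epi (ext_exact y).2).
have ysu : ext_sur y' ∘ (s ∘ u) = p by rewrite compA ys.
split=> [/(_ u yu)[w xw]|/(_ _ ysu)[w' xw']].
  apply: (syzygy_lifts1 (u := s ∘ u) (w := t ∘ w)) => //.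
  by rewrite (compA (ext_sur x')) xt -compA compA -sy -compA xw compA.
have [|w yw] := kernel_lift (g := u ∘ k) (ext_exact y).1.
  by rewrite compA yu kp.1.1.
(* Conversely, [x] is the pullback of [x'] along [h], so a lift to [x'] is a
   lift to [x]. *)
have pb := short_exact_mor_pullback abC (ext_exact x) (ext_exact x')
  (etrans tx (compm1 _)) xt.
have [|v [xv _]] := pullback_lift (u := w) (v := w') pb.
  apply: (kernel_mono (ext_exact y').1).
  by rewrite xw' compA -sy -compA yw compA.
by apply: (syzygy_lifts1 (u := u) (w := v)); rewrite // xv yw.
Qed.

(** The predicate is constant on Yoneda classes and holds for the sequence
    0 -> B -> B -> A -> A -> 0 with zero middle map. *)
Lemma Ext2_zero_syzygy_lifts (e : yext 1 A B) :
  Ext_zero 2 A B -> syzygy_lifts e.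
Proof.
have [Z Z0] := abelian_zero abC; have [Z0l Z0r] := (fun X => (Z0 X).1, fun X => (Z0 X).2).
have xe : short_exact (idm B) (0 : hom B Z).
  apply: (mono_short_exact abC) => [W u v|]; first by rewrite !comp1m.
  split=> [|W f]; first by rewrite compm1.
  by rewrite compm1 => ->; exists 0; split=> [|g _]; rewrite ?comp0m // Z0r.
have ye : short_exact (0 : hom Z A) (idm A).
  apply: (epi_short_exact abC) => [W u v|]; first by rewrite !compm1.
  split=> [|W f]; first by rewrite comp1m.
  by rewrite comp1m => ->; exists 0; split=> [|g _]; rewrite ?comp0m // Z0l.
pose e0 : yext 1 A B := existT _ Z (Extension xe, Extension ye).
move=> ext0; have [e0e _] : syzygy_lifts e0 <-> syzygy_lifts e.
  elim: {e}(ext0 e0 e) => [e e' /yext_mor_syzygy|e|e e' _ ->|e e' e'' _ -> _ ->] //.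
apply/e0e/(syzygy_lifts1 (y := Extension ye) (u := p) (w := 0)) => /=.
  by rewrite comp1m.
by rewrite kp.1.1 comp0m.
Qed.

End Syzygy.

(** An epi with kernel [B] followed by a mono with cokernel [A] can be
    rewritten as a mono with cokernel [A] followed by an epi with kernel [B]:
    the obstruction is the Yoneda product of the two sequences. The object [P]
    is the pushout of a projective presentation of [A] along the lift of the
    syzygy to [P1]. *)
Lemma Ext2_zero_swap A B P1 J P2 (b : hom B P1) (g : hom P1 J) (j : hom J P2)
    (c : hom P2 A) : enough_projectives C -> Ext_zero 2 A B ->
  short_exact b g -> short_exact j c ->
  exists P (s : hom P1 P) (c' : hom P A) (b' : hom B P) (v : hom P P2),
    [/\ short_exact s c', short_exact b' v & v ∘ s = j ∘ g].
Proof.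
move=> proj ext0 bg jc; have [Q [p [projQ ep]]] := proj A.
have [O [k kp]] := epi_kernel_exists abC ep.
have [u cu] := projQ _ _ c p (cokernel_epi jc.2).
have /(_ u cu)[w /= gw] := Ext2_zero_syzygy_lifts projQ kp
  (existT _ J (Extension bg, Extension jc)) ext0.
have [P [s [c' [h [sc c'h hk]]]]] := short_exact_pushout abC w kp.
have po := short_exact_mor_pushout kp sc c'h hk.
have [|v [vs vh]] := pushout_desc (u := j ∘ g) (v := u) po.
  by rewrite -compA gw.
have cv : c ∘ v = c'.
  apply: (pushout_inj po).
    by rewrite -compA vs compA jc.1.1 comp0m sc.1.1.
  by rewrite -compA vh cu c'h.
have po' := short_exact_mor_pushout sc jc cv vs.
exists P, s, c', (s ∘ b), v; split=> //; apply: mono_short_exact => //.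
  by apply: mono_comp; [exact: kernel_mono sc.1|exact: kernel_mono bg.1].
apply: epi_cokernel.
- move=> W z z' e; apply: (pushout_inj po') => //.
  by apply: (cokernel_epi bg.2); rewrite -!compA -vs !compA e.
- by rewrite compA vs -compA bg.1.1 compm0.
- move=> W z; rewrite compA => /(cokernel_lift bg.2)[t tg].
  by have [x [_ xv]] := pushout_desc (u := t) (v := z) po' tg; exists x.
Qed.

End Ext2.

(** * Cotorsion pairs relative to a subcategory *)

Lemma image_factorization (C : category) (abC : abelian C) (X Y : C)
    (f : hom X Y) :
  exists (K J M : C) (k : hom K X) (q : hom X J) (m : hom J Y) (c : hom Y M),
    [/\ short_exact k q, short_exact m c & f = m ∘ q].
Proof.
have [K [k kf]] := abelian_kernel abC f.
have [J [q kq]] := mono_cokernel_exists abC (kernel_mono kf).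
have [m mq] := cokernel_lift kq.2 kf.1.
have mm : mono m.
  apply/monoP => W w mw.
  have [P [v [w' [q' [vw _ pb]]]]] := short_exact_pullback abC w kq.
  have [|u ku] := kernel_lift (g := q') kf.
    by rewrite -mq -compA pb.1 compA mw comp0m.
  have/epiP := cokernel_epi vw.2; apply.
  by rewrite -pb.1 -ku compA kq.1.1 comp0m.
have [M [c mc]] := mono_cokernel_exists abC mm.
by exists K, J, M, k, q, m, c.
Qed.

Section OppositeSubcategories.
Variable C : category.
Implicit Types P Q : C -> Prop.

Lemma biproduct_opP (A B X : C) : @biproduct (op C) A B X <-> biproduct A B X.
Proof. by split=> [/biproduct_op|/biproduct_op]. Qed.

Lemma additive_subcat_op P : @additive_subcat (op C) P <-> additive_subcat P.
Proof.
split=> -[i z b]; split=> [X Y [f [g [gf fg]]]||A B PA PB].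
- by apply: i; exists g, f.
- by have [Z /zero_objectP Z0 PZ] := z; exists Z => //; apply/zero_objectP.
- by have [X bX PX] := b A B PA PB; exists X => //; apply/biproduct_opP.
- by apply: i; exists g, f.
- by have [Z /zero_objectP Z0 PZ] := z; exists Z => //; apply/zero_objectP.
- by have [X bX PX] := b A B PA PB; exists X => //; apply/biproduct_opP.
Qed.

Lemma summand_closed_op P : @summand_closed (op C) P <-> summand_closed P.
Proof. by split=> sP A B X /biproduct_opP; apply: sP. Qed.

Lemma extension_closed_op P : @extension_closed (op C) P <-> extension_closed P.
Proof.
by split=> eP A B D f g /short_exact_op fg PA PD; apply: eP fg PD PA.
Qed.

Lemma factors_through_op P (X Y : C) (f : hom X Y) :
  @factors_through (op C) P Y X f <-> factors_through P f.
Proof. by split=> -[Z [a [b [PZ e]]]]; exists Z, b, a. Qed.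

End OppositeSubcategories.

(** A cotorsion pair of a full subcategory [N] of [C], with all exact sequences
    taken in [C], so that it dualizes without changing [N]. *)
Record relative_cotorsion_pair (C : category) (N S V : C -> Prop) : Prop := {
  rel_additivel : additive_subcat S;
  rel_additiver : additive_subcat V;
  rel_summandl : summand_closed S;
  rel_summandr : summand_closed V;
  rel_extl : extension_closed S;
  rel_extr : extension_closed V;
  rel_subl : sub_subcat S N;
  rel_subr : sub_subcat V N;
  rel_Ext1 : forall A B, S A -> V B -> Ext_zero 1 A B;
  rel_resl : forall X, N X -> exists (V0 S0 : C) (k : hom V0 S0) (p : hom S0 X),
    [/\ V V0, S S0 & short_exact k p];
  rel_resr : forall X, N X -> exists (V0 S0 : C) (j : hom X V0) (c : hom V0 S0),
    [/\ V V0, S S0 & short_exact j c] }.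

Lemma relative_cotorsion_pair_op (C : category) (abC : abelian C)
    (N S V : C -> Prop) :
  relative_cotorsion_pair N S V -> @relative_cotorsion_pair (op C) N V S.
Proof.
case=> aS aV sS sV eS eV NS NV ext rl rr; split=> //.
- exact/additive_subcat_op.
- exact/additive_subcat_op.
- exact/summand_closed_op.
- exact/summand_closed_op.
- exact/extension_closed_op.
- exact/extension_closed_op.
- by move=> A B VA SB; apply/(Ext1_zero_op abC)/ext.
- move=> X /rr[V0 [S0 [j [c [VV SS /short_exact_op jc]]]]].
  by exists S0, V0, c, j.
- move=> X /rl[V0 [S0 [j [c [VV SS /short_exact_op jc]]]]].
  by exists S0, V0, c, j.
Qed.

(** The objects orthogonal to all of [N], not just to [S], are plentiful up to
    [N]; together with resolutions inside [N] this is all that is needed to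
    resolve an arbitrary object by [S] and its orthogonal. *)
Definition perp_envelopes (C : category) (N : C -> Prop) : Prop :=
  forall X : C, exists (E M : C) (j : hom X E) (c : hom E M),
    [/\ short_exact j c, N M & forall A, N A -> Ext_zero 1 A E].

Definition perp_coenvelopes (C : category) (N : C -> Prop) : Prop :=
  forall X : C, exists (E M : C) (k : hom M E) (p : hom E X),
    [/\ short_exact k p, N M & forall A, N A -> Ext_zero 1 E A].

Section LeftCotorsionPair.
Variables (C : category) (abC : abelian C) (N S V : C -> Prop).
Hypothesis cot : relative_cotorsion_pair N S V.
Hypothesis envelope : perp_envelopes N.
Implicit Types X Y Z A B : C.

Let T := right_perp1 S.

Lemma sub_right_perp1 : sub_subcat V T.
Proof. by move=> X VX A SA; apply: (rel_Ext1 cot). Qed.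

(** Take an envelope [X -> E -> M] with [M] in [N], resolve [M] by an object of
    [S] with kernel in [V], and pull back: the new middle term is an extension
    of [E] by an object of [V], and its quotient by [X] is in [S]. *)
Lemma special_preenvelope X : exists (T0 S0 : C) (j : hom X T0) (c : hom T0 S0),
  [/\ T T0, S S0 & short_exact j c].
Proof.
have [E [M [j [c [jc NM extE]]]]] := envelope X.
have [V0 [S0 [k [p [VV SS kp]]]]] := rel_resl cot NM.
have [P [a [a' [b [b' [aa' bb' _ _ _]]]]]] := short_exact_pullback_epi abC jc kp.
exists P, S0, a, a'; split=> //.
apply: (right_perp1_ext abC bb'); first exact: sub_right_perp1.
by move=> A SA; apply: extE; apply: (rel_subl cot).
Qed.

Lemma special_left_approx X T0 S0 (j : hom X T0) (c : hom T0 S0) :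
  short_exact j c -> T T0 -> S S0 -> left_cotorsion_approx S T j.
Proof.
move=> jc TT SS; split; last by exists S0, c.
by split=> // T' f TT'; move/(Ext1_zero_extend abC): (TT' _ SS); apply; apply: jc.
Qed.

(** If [X] is in [S] and orthogonal to [S], its embedding into an object of [V]
    with cokernel in [S] splits. *)
Lemma meet_right_perp1 X : meet_subcat S T X <-> meet_subcat S V X.
Proof.
split=> -[SX]; last by move=> VX; split=> //; apply: sub_right_perp1.
move=> TX; split=> //.
have [V0 [S0 [j [c [VV SS jc]]]]] := rel_resr cot (rel_subl cot SX).
have [r rj] := proj1 (Ext1_zero_retraction abC _ _) (TX S0 SS) _ _ _ jc.
have [s [cs e]] := retraction_section jc rj.
apply: (rel_summandr cot (B := S0)) VV.
exists j, s, r, c; split=> //; last exact: jc.1.1.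
apply: (kernel_mono jc.1).
have jr : j ∘ r = idm V0 - s ∘ c by rewrite -e addrK.
by rewrite compA jr compm0 compBl comp1m -compA cs compm1 subrr.
Qed.

Lemma factors_through_meet X Y (f : hom X Y) :
  S X -> T Y -> factors_through (meet_subcat S V) f.
Proof.
move=> SX TY; have [T0 [S0 [j [c [TT SS jc]]]]] := special_preenvelope X.
have [_ /(_ Y f TY)[h hj]] := (special_left_approx jc TT SS).1.
exists T0, j, h; split=> //; apply/meet_right_perp1; split=> //.
exact: (rel_extl cot jc SX SS).
Qed.

Lemma left_cotorsion_pair_perp : left_cotorsion_pair S T.
Proof.
split.
- exact: rel_additivel cot.
- exact: right_perp1_additive.
- exact: rel_summandl cot.
- exact: right_perp1_summand.
- move=> X; have [T0 [S0 [j [c [TT SS jc]]]]] := special_preenvelope X.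
  by exists T0, j; apply: special_left_approx jc TT SS.
- move=> X Y f SX TY; have [Z [a [b [IZ e]]]] := factors_through_meet f SX TY.
  by exists Z, a, b; split=> //; apply/meet_right_perp1.
Qed.

Let I := meet_subcat S V.

(** Uniqueness of extensions along an approximation, modulo the ideal of [I]:
    a map that factors through [I] on [X] extends to one on [T0], and the
    difference factors through the cokernel in [S]. *)
Lemma left_approx_inj X T0 (j : hom X T0) T' (g : hom T0 T') :
  left_cotorsion_approx S T j -> T T' -> factors_through I (g ∘ j) ->
  factors_through I g.
Proof.
move=> [[TT ext] [S0 [c [SS jc]]]] TT' [I0 [a [b [II e]]]].
have [a' aj] := ext I0 a (sub_right_perp1 II.2).
have [|h hc] := cokernel_lift (g := g - b ∘ a') jc.2.
  by rewrite compBl e -compA aj subrr.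
have /asboolP hI := factors_through_meet h SS TT'.
have addI := additive_subcatI (rel_additivel cot) (rel_additiver cot).
have hI' : h ∘ c \in ideal addI T0 T' by apply: ideal_compr.
have bI : b ∘ a' \in ideal addI T0 T' by apply/asboolP; exists I0, a', b.
by apply/asboolP; have := rpredD hI' bI; rewrite hc subrK.
Qed.

End LeftCotorsionPair.

Section RightCotorsionPair.
Variables (C : category) (abC : abelian C) (N S V : C -> Prop).
Hypothesis cot : relative_cotorsion_pair N S V.
Hypothesis coenvelope : perp_coenvelopes N.
Implicit Types X Y Z A B : C.

Let U := left_perp1 V.
Let abO := abelian_op abC.
Let cotO := relative_cotorsion_pair_op abC cot.

Lemma right_perp1_op (M : C -> Prop) : @right_perp1 (op C) M = left_perp1 M.
Proof.
apply/funext => X; apply/propext.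
by split=> pX A MA; apply/(Ext1_zero_op abC); apply: pX.
Qed.

Lemma left_perp1_ext (M : C -> Prop) : extension_closed (left_perp1 M).
Proof.
rewrite -right_perp1_op; apply/extension_closed_op.
exact: (@right_perp1_ext (op C)).
Qed.

Lemma envelope_op : @perp_envelopes (op C) N.
Proof.
move=> X; have [E [M [k [p [/short_exact_op kp NM ext]]]]] := coenvelope X.
by exists E, M, p, k; split=> // A NA; apply/(Ext1_zero_op abC)/ext.
Qed.

Lemma right_cotorsion_approx_op X U0 (p : hom U0 X) (U' : C -> Prop) :
  @left_cotorsion_approx (op C) V U' X U0 p <-> right_cotorsion_approx U' V p.
Proof.
by split=> -[ap [V0 [k [VV /short_exact_op kp]]]]; split=> //; exists V0, k.
Qed.

Lemma sub_left_perp1 : sub_subcat S U.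
Proof. by rewrite /U -right_perp1_op; apply: (sub_right_perp1 cotO). Qed.

Lemma special_right_approx X U0 V0 (k : hom V0 U0) (p : hom U0 X) :
  short_exact k p -> U U0 -> V V0 -> right_cotorsion_approx U V p.
Proof.
move=> /short_exact_op kp; rewrite /U -right_perp1_op => UU VV.
exact/right_cotorsion_approx_op/(special_left_approx abO kp UU VV).
Qed.

Lemma meet_subcatC (P Q : C -> Prop) : meet_subcat P Q = meet_subcat Q P.
Proof. by apply/funext => X; apply/propext; split=> -[]. Qed.

Lemma meet_left_perp1 X : meet_subcat U V X <-> meet_subcat S V X.
Proof.
rewrite meet_subcatC (meet_subcatC S) /U -right_perp1_op.
exact: (meet_right_perp1 abO cotO X).
Qed.

Lemma right_cotorsion_pair_perp : right_cotorsion_pair U V.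
Proof.
have [aV aU sV sU ap fac] := left_cotorsion_pair_perp abO cotO envelope_op.
rewrite right_perp1_op -/U in aU sU ap fac.
split.
- exact/additive_subcat_op.
- exact/additive_subcat_op.
- exact/summand_closed_op.
- exact/summand_closed_op.
- move=> X; have [U0 [p ap0]] := ap X.
  by exists U0, p; apply/right_cotorsion_approx_op.
- move=> X Y f UX VY; rewrite meet_subcatC.
  exact/factors_through_op/fac.
Qed.

Lemma right_approx_inj X U0 (p : hom U0 X) U' (g : hom U' U0) :
  right_cotorsion_approx U V p -> U U' ->
  factors_through (meet_subcat S V) (p ∘ g) ->
  factors_through (meet_subcat S V) g.
Proof.
move=> /right_cotorsion_approx_op; rewrite meet_subcatC /U -right_perp1_op.
move=> ap UU /factors_through_op pg; apply/factors_through_op.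
exact: (left_approx_inj abO cotO envelope_op ap UU pg).
Qed.

End RightCotorsionPair.

(** * Universal arrows and adjoints *)

Lemma dep_choice (A : Type) (B : A -> Type) (P : forall x, B x -> Prop) :
  (forall x, exists y, P x y) -> exists f : forall x, B x, forall x, P x (f x).
Proof. by move=> h; exists (fun x => sval (cid (h x))) => x; case: cid. Qed.

(** [u] is a reflection of [X] into the full subcategory on [P]. *)
Definition left_universal (Q : category) (P : Q -> Prop) (X T : Q)
    (u : hom X T) : Prop :=
  [/\ P T, forall T' (f : hom X T'), P T' -> exists g, g ∘ u = f &
      forall T' (g g' : hom T T'), P T' -> g ∘ u = g' ∘ u -> g = g'].

(** The predicate [Phi] records how the reflection arrows were obtained, so
    that this information survives the choice of the functor. *)
Lemma reflection (Q : category) (P : Q -> Prop)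
    (Phi : forall X T : Q, hom X T -> Prop) :
  (forall X, exists T (u : hom X T), left_universal P u /\ Phi X T u) ->
  exists (L : functor Q (full_subcat P)) (adj : adjunction L (inclusion P)),
    forall X, left_universal P (adj_unit adj X) /\ Phi _ _ (adj_unit adj X).
Proof.
move=> /dep_choice[T /dep_choice[u hu]].
have PT X : P (T X) by have [[]] := hu X.
have inj X T' (g g' : hom (T X) T') : P T' -> g ∘ u X = g' ∘ u X -> g = g'.
  by have [[_ _ uniq] _] := hu X; apply: uniq.
have /dep_choice[e eE] : forall x : {X : Q & {T' : full_subcat P & hom X (sval T')}},
    exists g : hom (T (projT1 x)) (sval (projT1 (projT2 x))),
    g ∘ u (projT1 x) = projT2 (projT2 x).
  move=> [X [[T' PT'] f]] /=; have [[_ ext _] _] := hu X.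
  exact: ext.
pose ext X (T' : full_subcat P) f := e (existT _ X (existT _ T' f)).
have extE X (T' : full_subcat P) (f : hom X (sval T')) : ext X T' f ∘ u X = f.
  exact: eE (existT _ X (existT _ T' f)).
pose LT X : full_subcat P := exist _ (T X) (PT X).
pose Lm X Y (f : hom X Y) : hom (LT X) (LT Y) := ext X (LT Y) (u Y ∘ f).
have LmE X Y (f : hom X Y) : @comp Q _ _ _ (Lm X Y f) (u X) = u Y ∘ f.
  exact: extE.
have L1 X : Lm X X (idm X) = idm (LT X).
  apply: inj; first exact: PT.
  by rewrite LmE [RHS]comp1m compm1.
have LM X Y Z (g : hom Y Z) (f : hom X Y) :
    Lm X Z (g ∘ f) = Lm Y Z g ∘ Lm X Y f.
  apply: inj; first exact: PT.
  rewrite LmE; apply: etrans _ (compA (c := Q) _ _ _).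
  by rewrite LmE compA [RHS]compA LmE.
pose L := Functor L1 LM.
have unit_nat X X' (f : hom X X') :
    u X' ∘ f = fmap (inclusion P) (fmap L f) ∘ u X by rewrite LmE.
pose counit (Y : full_subcat P) : hom (L (inclusion P Y)) Y :=
  ext (sval Y) Y (idm _).
have cE Y : @comp Q _ _ _ (counit Y) (u (sval Y)) = idm _ by apply: extE.
have counit_nat Y Y' (g : hom Y Y') :
    counit Y' ∘ fmap L (fmap (inclusion P) g) = g ∘ counit Y.
  apply: inj; first exact: (svalP Y').
  apply: etrans (esym (compA (c := Q) _ _ _)) _; rewrite LmE compA cE comp1m.
  by apply: etrans _ (compA (c := Q) _ _ _); rewrite cE compm1.
have triL X : counit (L X) ∘ fmap L (u X : hom X (inclusion P (L X))) = idm (L X).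
  apply: inj; first exact: PT.
  apply: etrans (esym (compA (c := Q) _ _ _)) _; rewrite LmE compA.
  by rewrite (cE (LT X)).
have triR Y : fmap (inclusion P) (counit Y) ∘ u (inclusion P Y) = idm _.
  exact: cE.
by exists L, (@Build_adjunction _ _ L (inclusion P) u counit unit_nat counit_nat
  triL triR).
Qed.

Definition right_universal (Q : category) (P : Q -> Prop) (U X : Q)
    (p : hom U X) : Prop :=
  [/\ P U, forall U' (f : hom U' X), P U' -> exists g, p ∘ g = f &
      forall U' (g g' : hom U' U), P U' -> p ∘ g = p ∘ g' -> g = g'].

Lemma coreflection (Q : category) (P : Q -> Prop)
    (Phi : forall X U : Q, hom U X -> Prop) :
  (forall X, exists U (p : hom U X), right_universal P p /\ Phi X U p) ->
  exists (R : functor Q (full_subcat P)) (adj : adjunction (inclusion P) R),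
    forall X, right_universal P (adj_counit adj X) /\ Phi _ _ (adj_counit adj X).
Proof.
move=> /(@reflection (op Q) P Phi)[[Lo Lm L1 LM] [[u c un cn tL tR] h]].
pose R : functor Q (full_subcat P) :=
  @Functor Q (full_subcat P) Lo (fun X Y f => Lm Y X f) L1
    (fun X Y Z g f => LM Z Y X f g).
exists R, (@Build_adjunction _ _ (inclusion P) R c u
  (fun X X' f => esym (cn X' X f)) (fun X X' f => esym (un X' X f)) tR tL).
exact: h.
Qed.

Lemma left_universal_iso (Q : category) (P : Q -> Prop) (X T T' : Q)
    (u : hom X T) (u' : hom X T') :
  left_universal P u -> left_universal P u' ->
  exists a : hom T T', is_iso a /\ a ∘ u = u'.
Proof.
move=> [PT ex un] [PT' ex' un']; have [[a au] [b bu]] := (ex _ u' PT', ex' _ u PT).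
exists a; split=> //; exists b; split.
  by apply: un => //; rewrite -compA au bu comp1m.
by apply: un' => //; rewrite -compA bu au comp1m.
Qed.

Lemma right_universal_iso (Q : category) (P : Q -> Prop) (U U' X : Q)
    (p : hom U X) (p' : hom U' X) :
  right_universal P p -> right_universal P p' ->
  exists a : hom U U', is_iso a /\ p' ∘ a = p.
Proof.
move=> [PT ex un] [PT' ex' un']; have [[b bu] [a au]] := (ex _ p' PT', ex' _ p PT).
exists a; split=> //; exists b; split.
  by apply: un => //; rewrite compA bu au compm1.
by apply: un' => //; rewrite compA au bu compm1.
Qed.

Lemma is_iso_comp (Q : category) (X Y Z : Q) (g : hom Y Z) (f : hom X Y) :
  is_iso g -> is_iso f -> is_iso (g ∘ f).
Proof.
move=> [g' [g'g gg']] [f' [f'f ff']]; exists (f' ∘ g'); split.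
  by rewrite compA -(compA f') g'g compm1.
by rewrite compA -(compA g) ff' compm1.
Qed.

(** There is at most one map [h] from [L R X] to [R L X] such that [h] with the
    unit before it and the counit after it is the composite
    [R X -> X -> L X]; uniqueness gives naturality. An object [W] through
    which this composite factors by a reflection followed by a coreflection is
    isomorphic to both ends, which gives existence and invertibility. *)
Lemma nat_isomorphic_LR (Q : category) (U T : Q -> Prop)
    (R : functor Q (full_subcat U)) (adjR : adjunction (inclusion U) R)
    (L : functor Q (full_subcat T)) (adjL : adjunction L (inclusion T)) :
  (forall X, left_universal T (adj_unit adjL X)) ->
  (forall X, right_universal U (adj_counit adjR X)) ->
  (forall X, T (inclusion U (R (inclusion T (L X))))) ->
  (forall X, exists (W : Q) (u : hom (inclusion U (R X)) W)
     (t : hom W (inclusion T (L X))),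
     [/\ left_universal T u, right_universal U t &
         t ∘ u = adj_unit adjL X ∘ adj_counit adjR X]) ->
  nat_isomorphic (inclusion T ∘F L ∘F inclusion U ∘F R)
                 (inclusion U ∘F R ∘F inclusion T ∘F L).
Proof.
move=> unitP counitP TRL WP.
have /dep_choice[h hP] : forall X, exists h : hom
    ((inclusion T ∘F L ∘F inclusion U ∘F R) X)
    ((inclusion U ∘F R ∘F inclusion T ∘F L) X), is_iso h /\
    adj_counit adjR (inclusion T (L X)) ∘ (h ∘ adj_unit adjL (inclusion U (R X))) =
    adj_unit adjL X ∘ adj_counit adjR X.
  move=> X; have [W [u [t [lu rt tu]]]] := WP X.
  have [a [ia au]] := left_universal_iso (unitP (inclusion U (R X))) lu.
  have [b [ib bt]] := right_universal_iso rt (counitP (inclusion T (L X))).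
  exists (b ∘ a); split; first exact: is_iso_comp.
  by rewrite -(compA b) au compA bt.
exists h; split=> [X Y f|X]; last by have [] := hP X.
have [_ _ injL] := unitP (inclusion U (R X)).
have [_ _ injR] := counitP (inclusion T (L Y)).
apply: injL; first exact: TRL.
apply: injR; first exact: svalP (R X).
have [[_ hX] [_ hY]] := (hP X, hP Y).
have unat := adj_unit_nat adjL; have cnat := adj_counit_nat adjR.
pose f' := fmap (inclusion T) (fmap L f).
have -> : fmap (inclusion U ∘F R ∘F inclusion T ∘F L) f =
  fmap (inclusion U) (fmap R f') by [].
rewrite -(compA (h Y)) -(unat _ _ (fmap (inclusion U) (fmap R f))).
rewrite (compA (h Y)) (compA (adj_counit _ _)) hY -compA cnat.
rewrite -(compA (fmap _ _)) (compA (adj_counit _ _)) cnat.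
by rewrite -(compA f') hX !compA unat.
Qed.

(** * The generalized Hovey twin cotorsion pair *)

Section TwinCotorsionPair.
Variables (C : category) (abC : abelian C) (N S V : C -> Prop).
Hypothesis cot : relative_cotorsion_pair N S V.
Hypothesis envelope : perp_envelopes N.
Hypothesis coenvelope : perp_coenvelopes N.
Hypothesis projC : enough_projectives C.
Hypothesis ext2 : forall A B, S A -> V B -> Ext_zero 2 A B.
Variable addI : additive_subcat (meet_subcat S V).
Implicit Types X Y Z A B : C.

Let T := right_perp1 S.
Let U := left_perp1 V.
Let Q := quot_cat addI.

Lemma quot_left_universal X T0 (j : hom X T0) : left_cotorsion_approx S T j ->
  @left_universal Q T X T0 (quot_pi addI j).
Proof.
move=> jap; have [[TT ext] _] := jap; split=> // T' => [f TT'|g g' TT'].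
  have [g gj] := ext _ (quot_repr f) TT'.
  by exists (quot_pi addI g); rewrite /= -quot_piM gj quot_reprK.
rewrite -(quot_reprK g) -(quot_reprK g') /= -!quot_piM => /quot_piE.
rewrite -compBl => /(left_approx_inj abC cot envelope jap TT') gg'.
exact/quot_piE.
Qed.

Lemma quot_right_universal X U0 (p : hom U0 X) : right_cotorsion_approx U V p ->
  @right_universal Q U U0 X (quot_pi addI p).
Proof.
move=> pap; have [[UU ext] _] := pap; split=> // U' => [f UU'|g g' UU'].
  have [g pg] := ext _ (quot_repr f) UU'.
  by exists (quot_pi addI g); rewrite /= -quot_piM pg quot_reprK.
rewrite -(quot_reprK g) -(quot_reprK g') /= -!quot_piM => /quot_piE.
rewrite -compBr => /(right_approx_inj abC cot coenvelope pap UU') gg'.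
exact/quot_piE.
Qed.

(** This is where Ext^2(S, V) = 0 enters: it swaps the epi [p] and the
    mono [j]. *)
Lemma twin_approx X U0 T0 (p : hom U0 X) (j : hom X T0) :
  right_cotorsion_approx U V p -> left_cotorsion_approx S T j ->
  exists (W : C) (u : hom U0 W) (t : hom W T0),
    [/\ left_cotorsion_approx S T u, right_cotorsion_approx U V t &
        t ∘ u = j ∘ p].
Proof.
move=> [[UU _] [V0 [k [VV kp]]]] [[TT _] [S0 [c [SS jc]]]].
have [W [u [c' [b [t [uc bt e]]]]]] := Ext2_zero_swap abC projC (ext2 SS VV) kp jc.
exists W, u, t; split=> //.
  apply: (special_left_approx abC uc) => //.
  by apply: (right_perp1_ext abC bt) => //; apply: (sub_right_perp1 cot).
apply: (special_right_approx abC bt) => //.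
by apply: (left_perp1_ext abC uc) => //; apply: (sub_left_perp1 abC cot).
Qed.

Lemma LR_commute_perp : LR_commute T U addI.
Proof.
have [|R [adjR RP]] := @coreflection Q U (fun X U0 p' => exists p : hom (U0 : C) X,
    right_cotorsion_approx U V p /\ p' = quot_pi addI p).
  move=> X; have [U0 [p pap]] := rcp_approx (right_cotorsion_pair_perp abC cot coenvelope) X.
  exists U0, (quot_pi addI p); split; first exact: quot_right_universal.
  by exists p.
have [|L [adjL LP]] := @reflection Q T (fun X T0 j' => exists j : hom X (T0 : C),
    left_cotorsion_approx S T j /\ j' = quot_pi addI j).
  move=> X; have [T0 [j jap]] := lcp_approx (left_cotorsion_pair_perp abC cot envelope) X.
  exists T0, (quot_pi addI j); split; first exact: quot_left_universal.
  by exists j.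
exists R, adjR, L, adjL; split=> [X|X|]; [by have [_] := RP X|by have [_] := LP X|].
have [|||| t [nat_t iso_t]] := @nat_isomorphic_LR Q U T R adjR L adjL.
- by move=> X; have [] := LP X.
- by move=> X; have [] := RP X.
- move=> X; have [_ [p [[[UU _] [V0 [k [VV kp]]]] _]]] := RP (inclusion (T : Q -> Prop) (L X)).
  apply: (right_perp1_ext abC kp); first exact: (sub_right_perp1 cot).
  exact: (svalP (L X)).
- move=> X; have [_ [p [pap ->]]] := RP X; have [_ [j [jap ->]]] := LP X.
  have [W [u [t [uap tap e]]]] := twin_approx pap jap.
  exists W, (quot_pi addI u), (quot_pi addI t); split.
  + exact: quot_left_universal.
  + exact: quot_right_universal.
  + by rewrite /= -!quot_piM e.
exists t; split=> [X Y f|X]; first exact: nat_t.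
exact: iso_t.
Qed.

End TwinCotorsionPair.

Lemma gHTCP_perp (C : category) (abC : abelian C) (N S V : C -> Prop)
    (cot : relative_cotorsion_pair N S V)
    (envelope : perp_envelopes N)
    (coenvelope : perp_coenvelopes N) :
  enough_projectives C -> (forall A B, S A -> V B -> Ext_zero 2 A B) ->
  gHTCP S (right_perp1 S) (left_perp1 V) V.
Proof.
move=> projC ext2; apply: (@Build_gHTCP C S _ _ V
  (left_cotorsion_pair_perp abC cot envelope)
  (right_cotorsion_pair_perp abC cot coenvelope)).
- exact: (sub_left_perp1 abC cot).
- exact: (sub_right_perp1 cot).
- by move=> X; rewrite (meet_right_perp1 abC cot) (meet_left_perp1 abC cot).
- exact: (LR_commute_perp abC cot envelope coenvelope projC ext2).
Qed.

(** * Functors with adjoints on both sides *)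

Record exact_functor (C D : category) (F : functor C D) : Prop := {
  exact_add : forall X Y (f g : hom X Y), fmap F (f + g) = fmap F f + fmap F g;
  exact_kernel : forall K X Y (k : hom K X) (f : hom X Y),
    is_kernel k f -> is_kernel (fmap F k) (fmap F f);
  exact_cokernel : forall X Y Q (c : hom Y Q) (f : hom X Y),
    is_cokernel c f -> is_cokernel (fmap F c) (fmap F f) }.

Definition op_functor (C D : category) (F : functor C D) :
    functor (op C) (op D) :=
  @Functor (op C) (op D) F (fun X Y f => @fmap _ _ F Y X f) (fmap1 F)
    (fun _ _ _ g f => fmapM F f g).

Definition op_adjunction (C D : category) (F : functor C D) (G : functor D C)
    (adj : adjunction F G) : adjunction (op_functor G) (op_functor F) :=
  @Build_adjunction (op D) (op C) (op_functor G) (op_functor F)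
    (adj_counit adj) (adj_unit adj)
    (fun _ _ f => esym (adj_counit_nat adj f))
    (fun _ _ f => esym (adj_unit_nat adj f))
    (adj_triangleR adj) (adj_triangleL adj).

Section RightAdjoint.
Variables (C D : category) (L : functor C D) (R : functor D C).
Variable adj : adjunction L R.
Let eta := adj_unit adj.
Let eps := adj_counit adj.

Lemma adj_transposeK X Y (f : hom (L X) Y) :
  eps Y ∘ fmap L (fmap R f ∘ eta X) = f.
Proof. by rewrite fmapM compA adj_counit_nat -compA adj_triangleL compm1. Qed.

Lemma adj_cotransposeK X Y (g : hom X (R Y)) :
  fmap R (eps Y ∘ fmap L g) ∘ eta X = g.
Proof. by rewrite fmapM -compA -adj_unit_nat compA adj_triangleR comp1m. Qed.

Lemma adj_transpose_inj X Y (f f' : hom (L X) Y) :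
  fmap R f ∘ eta X = fmap R f' ∘ eta X -> f = f'.
Proof. by move=> e; rewrite -(adj_transposeK f) e adj_transposeK. Qed.

Lemma adj_cotranspose_inj X Y (g g' : hom X (R Y)) :
  eps Y ∘ fmap L g = eps Y ∘ fmap L g' -> g = g'.
Proof. by move=> e; rewrite -(adj_cotransposeK g) e adj_cotransposeK. Qed.

Lemma right_adjoint_mono X Y (f : hom X Y) : mono f -> mono (fmap R f).
Proof.
move=> mf W g h gh; apply: adj_cotranspose_inj; apply: mf.
by rewrite !compA -!(adj_counit_nat adj) -!compA -!fmapM gh.
Qed.

Hypothesis abD : abelian D.

Lemma right_adjoint0 X Y : fmap R (0 : hom X Y) = 0.
Proof.
have [Z Z0] := abelian_zero abD.
have RZ0 : idm (R Z) = 0.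
  by apply: adj_cotranspose_inj; rewrite (proj1 (Z0 _) (_ ∘ _)) [RHS](proj1 (Z0 _)).
rewrite -(comp0m Y (0 : hom X Z)) fmapM -(comp1m (fmap R (0 : hom X Z))) RZ0.
by rewrite comp0m compm0.
Qed.

(** A right adjoint preserves products, and in an abelian category the
    addition of morphisms is recovered from biproducts. *)
Lemma right_adjointD X Y (f g : hom X Y) :
  fmap R (f + g) = fmap R f + fmap R g.
Proof.
have [P [i1 [i2 [p1 [p2 [e11 e22 e12 e21 e]]]]]] := abelian_biproduct abD Y Y.
have joint W (u v : hom W (R P)) :
    fmap R p1 ∘ u = fmap R p1 ∘ v -> fmap R p2 ∘ u = fmap R p2 ∘ v -> u = v.
  move=> uv1 uv2; apply: adj_cotranspose_inj.
  have push p : fmap R p ∘ u = fmap R p ∘ v ->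
      p ∘ (eps P ∘ fmap L u) = p ∘ (eps P ∘ fmap L v) :> hom _ Y.
    by move=> uv; rewrite !compA -!(adj_counit_nat adj) -!compA -!fmapM uv.
  by rewrite -[LHS]comp1m -[RHS]comp1m -e !compDl -!compA (push p1) ?(push p2).
have split_sum : fmap R (i1 ∘ f + i2 ∘ g) =
    fmap R i1 ∘ fmap R f + fmap R i2 ∘ fmap R g.
  apply: joint; rewrite [RHS]compDr !compA -!fmapM compDr !compA.
    by rewrite e11 e12 !comp0m right_adjoint0 !addr0.
  by rewrite e22 e21 !comp0m right_adjoint0 !add0r.
have -> : f + g = (p1 + p2) ∘ (i1 ∘ f + i2 ∘ g).
  rewrite compDl !compDr !compA e11 e12 e21 e22 !comp0m !comp1m addr0.
  by rewrite add0r.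
rewrite fmapM split_sum compDr !compA -!fmapM !compDl e11 e12 e21 e22.
by rewrite !comp0m !comp1m addr0 add0r.
Qed.

Lemma right_adjoint_kernel K X Y (k : hom K X) (f : hom X Y) :
  is_kernel k f -> is_kernel (fmap R k) (fmap R f).
Proof.
move=> kf; apply: mono_kernel.
- exact: right_adjoint_mono (kernel_mono kf).
- by rewrite -fmapM kf.1 right_adjoint0.
move=> W g fg; have [|u ku] := kernel_lift (g := eps X ∘ fmap L g) kf.
  apply: adj_transpose_inj.
  by rewrite fmapM -compA adj_cotransposeK fg right_adjoint0 comp0m.
by exists (fmap R u ∘ eta W); rewrite compA -fmapM ku adj_cotransposeK.
Qed.

End RightAdjoint.

Lemma adjoint_triple_exact (C D : category) (L R : functor D C)
    (F : functor C D) : abelian C -> adjunction L F -> adjunction F R ->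
  exact_functor F.
Proof.
move=> abC adjL adjR; split=> [X Y f g|K X Y k f|X Y Q c f].
- exact: (right_adjointD adjL abC).
- exact: (right_adjoint_kernel adjL abC).
exact: (right_adjoint_kernel (op_adjunction adjR) (abelian_op abC)).
Qed.

Lemma exact_functor_op (C D : category) (F : functor C D) :
  exact_functor F -> exact_functor (op_functor F).
Proof.
case=> FD Fk Fc; split=> [X Y f g|K X Y k f|X Y Q c f].
- exact: FD.
- exact: Fc.
- exact: Fk.
Qed.

Section ExactFunctor.
Variables (C D : category) (F : functor C D).
Hypothesis exF : exact_functor F.
Implicit Types X Y Z A B : C.

Lemma exact0 X Y : fmap F (0 : hom X Y) = 0.
Proof. by apply: (addIr (fmap F 0)); rewrite -exact_add // !add0r. Qed.

Lemma exactB X Y (f g : hom X Y) : fmap F (f - g) = fmap F f - fmap F g.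
Proof. by apply: (addIr (fmap F g)); rewrite -exact_add // !subrK. Qed.

Lemma exact_short_exact A B E (f : hom A B) (g : hom B E) :
  short_exact f g -> short_exact (fmap F f) (fmap F g).
Proof.
by move=> [kf cg]; split; [exact: exact_kernel|exact: exact_cokernel].
Qed.

Lemma exact_zero_object Z : zero_object Z -> zero_object (F Z).
Proof. by move=> /zero_objectP Z0; apply/zero_objectP; rewrite -fmap1 Z0 exact0. Qed.

Lemma exact_biproduct A B P : biproduct A B P -> biproduct (F A) (F B) (F P).
Proof.
move=> [i1 [i2 [p1 [p2 [e11 e22 e12 e21 e]]]]].
exists (fmap F i1), (fmap F i2), (fmap F p1), (fmap F p2).
by rewrite -!fmapM -exact_add // e11 e22 e12 e21 e !exact0 !fmap1.
Qed.

Lemma exact_zero_sub A B E (f : hom A B) (g : hom B E) :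
  short_exact f g -> fmap F f = 0 -> zero_object (F A).
Proof.
move=> /exact_short_exact[/kernel_mono mf _] f0; apply/zero_objectP/mf.
by rewrite f0 !comp0m.
Qed.

Lemma exact_zero_mid A B E (f : hom A B) (g : hom B E) :
  short_exact f g -> zero_object (F A) -> zero_object (F E) -> zero_object (F B).
Proof.
move=> /exact_short_exact[kf _] FA FE; apply/zero_objectP.
have [|u <-] := kernel_lift (g := idm (F B)) kf; first exact: (FE _).1.
by rewrite ((FA _).1 u) compm0.
Qed.

End ExactFunctor.

Lemma exact_zero_quot (C D : category) (F : functor C D) (A B E : C)
    (f : hom A B) (g : hom B E) :
  exact_functor F -> short_exact f g -> fmap F g = 0 -> zero_object (F E).
Proof.
move=> /exact_functor_op exF /short_exact_op fg g0.
apply/zero_objectP; apply/(@zero_objectP (op D)).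
exact: (exact_zero_sub exF fg).
Qed.

Section FullyFaithful.
Variables (C D : category) (F : functor C D).
Hypothesis ffF : fully_faithful F.
Implicit Types X Y Z A B : C.

Lemma ff_inj X Y (f g : hom X Y) : fmap F f = fmap F g -> f = g.
Proof. exact: (bij_inj (ffF X Y)). Qed.

Lemma ff_surj X Y (g : hom (F X) (F Y)) : exists f : hom X Y, fmap F f = g.
Proof. by have [h _ hK] := ffF X Y; exists (h g). Qed.

Hypothesis F0 : forall X Y, fmap F (0 : hom X Y) = 0.

Lemma ff_kernel K X Y (k : hom K X) (f : hom X Y) :
  is_kernel (fmap F k) (fmap F f) -> is_kernel k f.
Proof.
move=> kf; apply: mono_kernel.
- move=> W u v uv; apply: ff_inj; apply: (kernel_mono kf).
  by rewrite -!fmapM uv.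
- by apply: ff_inj; rewrite fmapM kf.1 F0.
move=> W g fg; have [|u ku] := kernel_lift (g := fmap F g) kf.
  by rewrite -fmapM fg F0.
by have [u' u'E] := ff_surj u; exists u'; apply: ff_inj; rewrite fmapM u'E.
Qed.

End FullyFaithful.

Lemma fully_faithful_op (C D : category) (F : functor C D) :
  fully_faithful F -> fully_faithful (op_functor F).
Proof. by move=> ff X Y; apply: ff. Qed.

Lemma ff_short_exact (C D : category) (F : functor C D) (A B E : C)
    (f : hom A B) (g : hom B E) : fully_faithful F ->
  (forall X Y, fmap F (0 : hom X Y) = 0) ->
  short_exact (fmap F f) (fmap F g) -> short_exact f g.
Proof.
move=> ff F0 [kf cg]; split; first exact: ff_kernel kf.
exact: (ff_kernel (fully_faithful_op ff) (fun X Y => F0 Y X) cg).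
Qed.

(** * Envelopes from injectives *)

Section Envelope.
Variables (C D : category) (e : functor C D) (r : functor D C).
Hypotheses (abC : abelian C) (exe : exact_functor e) (adj : adjunction e r).

(** Embed [X] into an injective [J] with cokernel [K], and let [E] be the kernel
    of the composite [J -> K -> r e K]. Maps from the kernel of [e] to
    [r e K] vanish, so extensions of such objects by [E] split: the inclusion of
    [E] into [J] extends by injectivity, and the extension lands in [E].
    As [e] turns the unit into a split mono, it kills [E/X]. *)
Lemma envelope_exists : enough_injectives C ->
  perp_envelopes (fun X => zero_object (e X)).
Proof.
move=> inj X; have [J [x [injJ mx]]] := inj X.
have [K [y xy]] := mono_cokernel_exists abC mx.
pose d := adj_unit adj K ∘ y.
have [E [k kd]] := abelian_kernel abC d.
have [j kj] : exists j, k ∘ j = x.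
  by apply: (kernel_lift kd); rewrite -compA xy.1.1 compm0.
have mj : mono j by apply: (@mono_compr _ _ _ _ k); rewrite kj.
have [M [c jc]] := mono_cokernel_exists abC mj.
exists E, M, j, c; split=> //.
  apply: (exact_zero_quot exe jc).
  have exy := exact_short_exact exe xy.
  (* By the triangle identity [e] of the unit is a split mono, so the kernel
     of [e d] is that of [e y]. *)
  have [|w ew] := kernel_lift (g := fmap e k) exy.1.
    rewrite -[LHS]comp1m -(adj_triangleL adj) -compA [X in _ ∘ X]compA -fmapM.
    by rewrite -fmapM kd.1 exact0 // compm0.
  have ejw : fmap e j ∘ w = idm _.
    apply: (kernel_mono (exact_kernel exe kd)).
    by rewrite compA -fmapM kj ew compm1.
  by rewrite -[LHS]compm1 -ejw compA -fmapM jc.1.1 exact0 // comp0m.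
move=> A A0; apply/(Ext1_zero_retraction abC) => F f g fg.
have [h hf] := injJ _ _ f k (kernel_mono fg.1).
have [|a ag] := cokernel_lift (g := d ∘ h) fg.2.
  by rewrite -compA hf kd.1.
have a0 : a = 0.
  apply: (@adj_cotranspose_inj _ _ _ _ adj A (e K)).
  by rewrite (proj2 (A0 _) (_ ∘ _)) [RHS](proj2 (A0 _)).
have [|t kt] := kernel_lift (g := h) kd; first by rewrite -ag a0 comp0m.
by exists t; apply: (kernel_mono kd); rewrite compA kt hf compm1.
Qed.

End Envelope.

Lemma coenvelope_exists (C D : category) (e : functor C D) (l : functor D C) :
  abelian C -> exact_functor e -> adjunction l e -> enough_projectives C ->
  perp_coenvelopes (fun X => zero_object (e X)).
Proof.
move=> abC exe adj proj X.
have injO : enough_injectives (op C).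
  move=> Y; have [P [p [projP ep]]] := proj Y.
  by exists P, p; split=> // U W g f; apply: projP.
have zeroO (Z : D) : zero_object Z <-> @zero_object (op D) Z.
  by rewrite !zero_objectP.
have [E [M [j [c [/short_exact_op jc M0 ext]]]]] := envelope_exists
  (abelian_op abC) (exact_functor_op exe) (op_adjunction adj) injO X.
exists E, M, c, j; split=> //; first exact/zeroO.
by move=> A /zeroO A0; apply/(Ext1_zero_op abC)/ext.
Qed.

(** * The induced equivalence *)

Lemma equivalence_of_ff_ess_surj (A B : category) (F : functor A B) :
  (forall X Y, injective (@fmap A B F X Y)) ->
  (forall X Y (g : hom (F X) (F Y)), exists f : hom X Y, fmap F f = g) ->
  (forall Y, exists X, isomorphic (F X) Y) -> is_equivalence F.
Proof.
move=> inj surj /dep_choice[G /dep_choice[t /dep_choice[t' tt']]].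
have t't Y : t' Y ∘ t Y = idm _ by have [] := tt' Y.
have {}tt' Y : t Y ∘ t' Y = idm _ by have [] := tt' Y.
have /dep_choice[h hE] : forall x : {X : A & {Y : A & hom (F X) (F Y)}},
    exists f : hom (projT1 x) (projT1 (projT2 x)), fmap F f = projT2 (projT2 x).
  by move=> [X [Y g]] /=.
pose lift X Y (g : hom (F X) (F Y)) : hom X Y := h (existT _ X (existT _ Y g)).
have liftE X Y (g : hom (F X) (F Y)) : fmap F (lift X Y g) = g.
  exact: hE (existT _ X (existT _ Y g)).
pose Gm X Y (g : hom X Y) : hom (G X) (G Y) := lift (G X) (G Y) (t' Y ∘ g ∘ t X).
have GmE X Y (g : hom X Y) : fmap F (Gm X Y g) = t' Y ∘ g ∘ t X by exact: liftE.
have G1 X : Gm X X (idm X) = idm _.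
  by apply: inj; rewrite GmE compm1 t't fmap1.
have GM X Y Z (g : hom Y Z) (f : hom X Y) : Gm X Z (g ∘ f) = Gm Y Z g ∘ Gm X Y f.
  apply: inj; rewrite fmapM !GmE !compA.
  by rewrite -(compA _ (t Y)) tt' compm1.
have nat_t X Y (g : hom X Y) : t Y ∘ fmap F (Gm X Y g) = g ∘ t X.
  by rewrite GmE !compA tt' comp1m.
exists (Functor G1 GM); split.
  exists (fun X => lift (G (F X)) X (t (F X))); split=> [X Y f|X].
    by apply: inj; rewrite !fmapM !liftE !compA tt' comp1m.
  exists (lift X (G (F X)) (t' (F X))).
  by split; apply: inj; rewrite fmapM !liftE ?t't ?tt' fmap1.
exists t; split=> [X Y f|X]; last first.
  by exists (t' X); split; [exact: t't|exact: tt'].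
exact: nat_t.
Qed.

Section Localization.
Variables (C D : category) (e : functor C D) (l : functor D C).
Hypotheses (abC : abelian C) (exe : exact_functor e) (adj : adjunction l e).
Let N X := zero_object (e X).
Implicit Types X Y Z A B : C.

(** For an extension [A -> E -> l Y] with [e A = 0] the map [e E -> e (l Y)] is
    invertible, and the transpose of its inverse after the unit is a
    section. *)
Lemma left_adjoint_perp (Y : D) A : N A -> Ext_zero 1 (l Y) A.
Proof.
move=> A0; apply/(Ext1_zeroP abC) => E f g fg.
have [ef cg] := exact_short_exact exe fg.
have [|u ug] := cokernel_lift (g := idm _) cg; first exact: (proj2 (A0 _)).
have gu : fmap e g ∘ u = idm _.
  by apply: (cokernel_epi cg); rewrite -compA ug compm1 comp1m.
exists (adj_counit adj E ∘ fmap l (u ∘ adj_unit adj Y)).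
apply: (@adj_transpose_inj _ _ _ _ adj).
by rewrite fmapM -compA adj_cotransposeK compA gu comp1m fmap1 comp1m.
Qed.

Lemma left_adjoint_ff_unit (Y : D) : fully_faithful l -> is_iso (adj_unit adj Y).
Proof.
move=> ff; have [h hE] := ff_surj ff (adj_counit adj (l Y)).
have hu : h ∘ adj_unit adj Y = idm Y.
  by apply: (ff_inj ff); rewrite fmapM hE adj_triangleL fmap1.
by exists h; split=> //; rewrite adj_unit_nat hE adj_triangleR.
Qed.

Lemma counit_invertible X : fully_faithful l -> is_iso (fmap e (adj_counit adj X)).
Proof.
move=> /(left_adjoint_ff_unit (e X))[h [hu uh]].
have cu := adj_triangleR adj X.
exists (adj_unit adj (e X)); split=> //.
have ch : fmap e (adj_counit adj X) = h.
  by rewrite -[LHS]compm1 -uh compA cu comp1m.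
by rewrite ch.
Qed.

Variables (S V : C -> Prop).
Hypothesis cot : relative_cotorsion_pair N S V.
Hypothesis projC : enough_projectives C.
Hypothesis ext2 : forall A B, S A -> V B -> Ext_zero 2 A B.

(** Split [a] into an epi and a mono, with kernel and cokernel in [N]. Resolving
    the kernel by [V] and the cokernel by [S] turns each half into a mono with
    cokernel in [S] followed by an epi with kernel in [V]. The two inner
    factors stand in the wrong order and are swapped using
    Ext^2(S, V) = 0. *)
Lemma localization_factorization X Y (a : hom X Y) : is_iso (fmap e a) ->
  exists (W V0 S0 : C) (s : hom X W) (c : hom W S0) (b : hom V0 W) (v : hom W Y),
    [/\ S S0, V V0, short_exact s c, short_exact b v & v ∘ s = a].
Proof.
move=> [a' [a'a aa']].
have [K [J [M [k [q [m [c [kq mc e_a]]]]]]]] := image_factorization abC a.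
have NK : N K.
  apply: (exact_zero_sub exe kq).
  rewrite -[LHS]comp1m -a'a -compA -fmapM e_a -compA kq.1.1 compm0.
  by rewrite exact0 // compm0.
have NM : N M.
  apply: (exact_zero_quot exe mc).
  rewrite -[LHS]compm1 -aa' compA -fmapM e_a compA mc.1.1 comp0m.
  by rewrite exact0 // comp0m.
have [V0 [S0 [j [d [VV0 SS0 jd]]]]] := rel_resr cot NK.
have [P [i' [p [i [p' [ip ip' pi _ _]]]]]] := short_exact_pushout_mono abC kq jd.
have [V1 [S1 [j1 [d1 [VV1 SS1 jd1]]]]] := rel_resl cot NM.
have [P1 [n [r' [n' [r [nr nr' rn _ _]]]]]] := short_exact_pullback_epi abC mc jd1.
have [W [s [c' [b [v [sc bv vs]]]]]] :=
  Ext2_zero_swap abC projC (ext2 SS1 VV0) ip nr.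
have [S2 [x [y [z [xy zz _ _]]]]] := short_exact_quotient abC sc ip'.
have [V2 [x' [y' [z' [xy' zz' _ _]]]]] := short_exact_preimage abC bv nr'.
exists W, V2, S2, (s ∘ i), z, z', (r ∘ v); split=> //.
- exact: (rel_extl cot xy).
- exact: (rel_extr cot xy').
- by rewrite -compA (compA v) vs -compA pi compA rn e_a.
Qed.

Lemma ideal_fmap0 X Y (f : hom X Y) :
  factors_through (meet_subcat S V) f -> fmap e f = 0.
Proof.
move=> [Z [a [b [[SZ _] ->]]]].
by rewrite fmapM (proj1 (rel_subl cot SZ _) (fmap e a)) compm0.
Qed.

(** The image [J] of [f] is in [N]; the map [X -> J] lifts along an epi
    from [S] with kernel in [V]. *)
Lemma localization_faithful X Y (f : hom X Y) : left_perp1 V X -> right_perp1 S Y ->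
  (forall Z (h : hom Z Y), S Z -> factors_through (meet_subcat S V) h) ->
  fmap e f = 0 -> factors_through (meet_subcat S V) f.
Proof.
move=> UX TY fac ef0.
have [K [J [M [k [q [m [c [kq mc fE]]]]]]]] := image_factorization abC f.
have NJ : N J.
  apply: (exact_zero_sub exe mc); apply: (cokernel_epi (exact_cokernel exe kq.2)).
  by rewrite -fmapM -fE ef0 comp0m.
have [V0 [S0 [k' [p [VV SS kp]]]]] := rel_resl cot NJ.
have [q' pq] := proj1 (Ext1_zero_lift abC _ _) (UX V0 VV) _ _ _ _ q kp.
have [Z [a [b [IZ ab]]]] := fac _ (m ∘ p) SS.
exists Z, (a ∘ q'), b; split=> //.
by rewrite fE -pq compA ab compA.
Qed.

(** Transpose [g] to a map [l (e X) -> Y] and factor the counit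
    [l (e X) -> X], which [e] inverts, as a mono [s] with cokernel in [S] and an
    epi [v] with kernel in [V]: the transpose extends along [s], and the
    identity of [X] lifts through [v]. *)
Lemma localization_full X Y (g : hom (e X) (e Y)) : fully_faithful l ->
  left_perp1 V X -> right_perp1 S Y -> exists f : hom X Y, fmap e f = g.
Proof.
move=> ffl UX TY.
have [W [V0 [S0 [s [c [b [v [SS VV sc bv vs]]]]]]]] :=
  localization_factorization (counit_invertible X ffl).
have [t ts] := proj1 (Ext1_zero_extend abC _ _) (TY S0 SS) _ _ _ _
  (adj_counit adj Y ∘ fmap l g) sc.
have [z vz] := proj1 (Ext1_zero_lift abC _ _) (UX V0 VV) _ _ _ _ (idm X) bv.
exists (t ∘ z).
have ez : fmap e z = fmap e s ∘ adj_unit adj (e X).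
  have [kv _] := exact_short_exact exe bv.
  have/monoP mv : mono (fmap e v).
    apply/monoP => W' w /(kernel_lift kv)[u <-].
    by rewrite (proj1 (rel_subr cot VV _) u) compm0.
  apply/eqP; rewrite -subr_eq0; apply/eqP/mv.
  rewrite compBr compA -!fmapM vz vs fmap1 (adj_triangleR adj) subrr //.
by rewrite fmapM ez compA -fmapM ts adj_cotransposeK.
Qed.

(** The object [l Y] is already orthogonal to [V]; approximating it by the
    orthogonal of [S] adds only an object of [S], invisible to [e]. *)
Lemma localization_ess_surj (Y : D) T0 S0 (j : hom (l Y) T0) (c : hom T0 S0) :
  fully_faithful l -> short_exact j c -> S S0 ->
  left_perp1 V T0 /\ isomorphic (e T0) Y.
Proof.
move=> ffl jc SS; split.
  apply: (left_perp1_ext abC jc); last exact: (sub_left_perp1 abC cot).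
  by move=> A VA; apply: left_adjoint_perp; apply: (rel_subr cot).
have [h [hu uh]] := left_adjoint_ff_unit Y ffl.
have [kj _] := exact_short_exact exe jc.
have [|u ju] := kernel_lift (g := idm _) kj.
  exact: (proj1 (rel_subl cot SS _)).
have uj : u ∘ fmap e j = idm _.
  by apply: (kernel_mono kj); rewrite compA ju comp1m compm1.
exists (h ∘ u), (fmap e j ∘ adj_unit adj Y); split.
  by rewrite -compA (compA _ h) uh comp1m.
by rewrite -compA (compA u) uj comp1m.
Qed.

Lemma localization_induces_equivalence (addI : additive_subcat (meet_subcat S V))
    (envelope : perp_envelopes N) :
  fully_faithful l ->
  induces_equivalence e (meet_subcat (right_perp1 S) (left_perp1 V)) addI.
Proof.
move=> ffl.
have eq_e X Y (f g : hom X Y) :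
    factors_through (meet_subcat S V) (f - g) -> fmap e f = fmap e g.
  move=> /ideal_fmap0/eqP; rewrite exactB // subr_eq0 => /eqP //.
exists eq_e; apply: equivalence_of_ff_ess_surj.
- move=> [X [TX UX]] [Y [TY UY]] f g /= fg.
  rewrite -(quot_reprK f) -(quot_reprK g); apply/quot_piE.
  apply: localization_faithful => //; last by rewrite exactB // fg subrr.
  by move=> Z h SZ; apply: (factors_through_meet abC cot envelope).
- move=> [X [TX UX]] [Y [TY UY]] g.
  have [f fE] := localization_full g ffl UX TY.
  exists (quot_pi addI f); apply: etrans fE; exact: quot_lift_pi.
- move=> Y.
  have [T0 [S0 [j [c [TT SS jc]]]]] := special_preenvelope abC cot envelope (l Y).
  have [UT iso] := localization_ess_surj ffl jc SS.
  by exists (exist _ T0 (conj TT UT)).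
Qed.

End Localization.

(** * Transport from the subcategory to the ambient category *)

Section IsoTransport.
Variable C : category.
Implicit Types X Y Z W A B D K P Q : C.

Lemma iso_mono X Y (f : hom X Y) : is_iso f -> mono f.
Proof.
move=> [g [gf _]] W u v e.
by rewrite -(comp1m u) -(comp1m v) -gf -!compA e.
Qed.

Lemma isomorphic_sym X Y : isomorphic X Y -> isomorphic Y X.
Proof. by move=> [f [g [gf fg]]]; exists g, f. Qed.

Lemma isomorphic_trans X Y Z :
  isomorphic X Y -> isomorphic Y Z -> isomorphic X Z.
Proof. by move=> [f isof] [g isog]; exists (g ∘ f); apply: is_iso_comp. Qed.

Lemma kernel_iso K K' X X' Y Y' (k : hom K X) (f : hom X Y) (a : hom K' K)
    (b : hom X X') (b' : hom X' X) (d : hom Y Y') :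
  is_iso a -> b' ∘ b = idm X -> b ∘ b' = idm X' -> mono d ->
  is_kernel k f -> is_kernel (b ∘ k ∘ a) (d ∘ f ∘ b').
Proof.
move=> isoa b'b bb' md kf; apply: mono_kernel.
- apply: mono_comp (iso_mono isoa); apply: mono_comp (kernel_mono kf).
  by apply: iso_mono; exists b'.
- by rewrite !compA -(compA _ b') b'b compm1 -(compA d) kf.1 compm0 comp0m.
move=> W w; rewrite -!compA => dw.
have [|u ku] := kernel_lift (g := b' ∘ w) kf.
  by apply: md; rewrite dw compm0.
have [a' [_ aa']] := isoa; exists (a' ∘ u).
by rewrite -!compA (compA a) aa' comp1m ku compA bb' comp1m.
Qed.

End IsoTransport.

Lemma short_exact_iso (C : category) (A A' B B' D D' : C) (f : hom A B)
    (g : hom B D) (a' : hom A' A) (b : hom B B') (b' : hom B' B)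
    (d : hom D D') :
  is_iso a' -> b' ∘ b = idm B -> b ∘ b' = idm B' -> is_iso d ->
  short_exact f g -> short_exact (b ∘ f ∘ a') (d ∘ g ∘ b').
Proof.
move=> isoa b'b bb' isod [kf cg]; split.
  by apply: kernel_iso => //; apply: iso_mono.
have opi (X Y : C) (h : @hom C X Y) : is_iso h -> @is_iso (op C) Y X h.
  by move=> [h' [? ?]]; exists h'.
have := @kernel_iso (op C) _ _ _ _ _ _ g f d b' b a' (opi _ _ _ isod) b'b bb'
  (iso_mono (opi _ _ _ isoa)) cg.
by rewrite /= !compA.
Qed.

Lemma biproduct_transport (C : category) (A A' B B' P P' : C) :
  isomorphic A A' -> isomorphic B B' -> isomorphic P P' ->
  biproduct A B P -> biproduct A' B' P'.
Proof.
move=> [a [a' [a'a aa']]] [b [b' [b'b bb']]] [d [d' [d'd dd']]].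
move=> [i1 [i2 [p1 [p2 [e11 e22 e12 e21 e]]]]].
have mid (X1 X2 X3 X4 : C) (x : hom P X2) (x' : hom X2 X1) (y : hom X3 P) (y' : hom X4 X3) :
    (x' ∘ x ∘ d') ∘ (d ∘ y ∘ y') = x' ∘ (x ∘ y) ∘ y'.
  by rewrite !compA -(compA _ d') d'd compm1.
exists (d ∘ i1 ∘ a'), (d ∘ i2 ∘ b'), (a ∘ p1 ∘ d'), (b ∘ p2 ∘ d'); split.
- by rewrite mid e11 compm1.
- by rewrite mid e22 compm1.
- by rewrite mid e12 compm0 comp0m.
- by rewrite mid e21 compm0 comp0m.
rewrite !compA -(compA _ a') a'a compm1 -(compA _ b') b'b compm1.
by rewrite -compDl -!compA -compDr e compm1.
Qed.

Section EssentialImage.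
Variables (N C D : category) (i : functor N C) (e : functor C D).
Hypotheses (abN : abelian N) (abC : abelian C).
Hypotheses (exi : exact_functor i) (exe : exact_functor e).
Hypothesis ffi : fully_faithful i.
Hypothesis im_ker : forall X : C,
  (exists A : N, isomorphic X (i A)) <-> zero_object (e X).
Variables S V : N -> Prop.
Hypothesis cot : cotorsion_pair S V.

(** The essential image of [i] is the kernel of [e], hence closed under
    extensions, and [i] is full: a short exact sequence with ends in the image
    comes from [N]. *)
Lemma ff_short_exact_iso (A B E : C) (f : hom A B) (g : hom B E) (A0 E0 : N) :
  short_exact f g -> isomorphic A (i A0) -> isomorphic E (i E0) ->
  exists (B0 : N) (f0 : hom A0 B0) (g0 : hom B0 E0) (b : hom B (i B0))
      (d : hom E (i E0)),
    [/\ short_exact f0 g0, is_iso b, is_iso d & d ∘ g = fmap i g0 ∘ b].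
Proof.
move=> fg isoA isoE; have [a [a' [a'a aa']]] := isoA; have [d isod] := isoE.
have /im_ker[B0 [b [b' [b'b bb']]]] : zero_object (e B).
  by apply: (exact_zero_mid exe fg); apply/im_ker; [exists A0|exists E0].
have [f0 f0E] := ff_surj ffi (b ∘ f ∘ a').
have [g0 g0E] := ff_surj ffi (d ∘ g ∘ b').
exists B0, f0, g0, b, d; split=> //.
- apply: (ff_short_exact ffi (fun X Y => exact0 exi X Y)); rewrite f0E g0E.
  by apply: short_exact_iso => //; exists a.
- by exists b'.
- by rewrite g0E -!compA b'b compm1.
Qed.

Lemma ess_image_iso (P : N -> Prop) (X Y : C) :
  isomorphic X Y -> ess_image i P X -> ess_image i P Y.
Proof.
move=> XY [A PA XA]; exists A => //.
exact: isomorphic_trans (isomorphic_sym XY) XA.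
Qed.

Lemma ess_image_additive (P : N -> Prop) :
  additive_subcat P -> additive_subcat (ess_image i P).
Proof.
move=> addP; split.
- exact: ess_image_iso.
- have [Z Z0 PZ] := subcat_zero addP; exists (i Z).
    exact: exact_zero_object.
  by exists Z => //; apply: isomorphic_refl.
- move=> A B [A0 PA AA0] [B0 PB BB0].
  have [X0 bX PX] := subcat_biproduct addP PA PB; exists (i X0).
    apply: biproduct_transport (exact_biproduct exi bX).
    + exact: isomorphic_sym.
    + exact: isomorphic_sym.
    + exact: isomorphic_refl.
  by exists X0 => //; apply: isomorphic_refl.
Qed.

Lemma ff_biproduct (A B P : N) : biproduct (i A) (i B) (i P) -> biproduct A B P.
Proof.
move=> [i1 [i2 [p1 [p2 [e11 e22 e12 e21 eP]]]]].
have [[j1 j1E] [j2 j2E]] := (ff_surj ffi i1, ff_surj ffi i2).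
have [[q1 q1E] [q2 q2E]] := (ff_surj ffi p1, ff_surj ffi p2).
exists j1, j2, q1, q2; split; apply: (ff_inj ffi).
- by rewrite fmapM j1E q1E fmap1.
- by rewrite fmapM j2E q2E fmap1.
- by rewrite fmapM j2E q1E exact0.
- by rewrite fmapM j1E q2E exact0.
- by rewrite exact_add // !fmapM j1E j2E q1E q2E fmap1.
Qed.

Lemma ess_image_summand (P : N -> Prop) :
  summand_closed P -> summand_closed (ess_image i P).
Proof.
move=> sP A B X bX [X0 PX XX0].
have X0z : zero_object (e X) by apply/im_ker; exists X0.
have [i1 [i2 [p1 [p2 [e11 e22 _ _ _]]]]] := bX.
have /im_ker[A0 AA0] : zero_object (e A).
  apply/zero_objectP; rewrite -fmap1 -e11 fmapM.
  by rewrite (proj1 (X0z _) (fmap e i1)) compm0.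
have /im_ker[B0 BB0] : zero_object (e B).
  apply/zero_objectP; rewrite -fmap1 -e22 fmapM.
  by rewrite (proj1 (X0z _) (fmap e i2)) compm0.
exists A0 => //; apply: sP PX; apply: ff_biproduct.
exact: (biproduct_transport AA0 BB0 XX0 bX).
Qed.

Lemma ess_image_extension (P : N -> Prop) :
  extension_closed P -> extension_closed (ess_image i P).
Proof.
move=> eP A B E f g fg [A0 PA AA0] [E0 PE EE0].
have [B0 [f0 [g0 [b [d [fg0 isob _ _]]]]]] := ff_short_exact_iso fg AA0 EE0.
by exists B0; [apply: eP fg0 PA PE|exists b].
Qed.

Lemma ess_image_Ext1 (A0 B0 : N) (A B : C) : isomorphic A (i A0) ->
  isomorphic B (i B0) -> Ext_zero 1 A0 B0 -> Ext_zero 1 A B.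
Proof.
move=> AA0 BB0 /(Ext1_zeroP abN) spl; apply/(Ext1_zeroP abC) => E f g fg.
have [E0 [f0 [g0 [b [d [fg0 isob isod dg]]]]]] := ff_short_exact_iso fg BB0 AA0.
have [s gs] := spl _ _ _ fg0; have [b' [b'b bb']] := isob.
exists (b' ∘ fmap i s ∘ d); apply: (iso_mono isod).
rewrite !compA dg -(compA _ b) bb' compm1 -fmapM gs fmap1 comp1m.
by rewrite compm1.
Qed.

Lemma ess_image_relative_cotorsion_pair :
  relative_cotorsion_pair (fun X => zero_object (e X))
    (ess_image i S) (ess_image i V).
Proof.
have imP (P : N -> Prop) X : P X -> ess_image i P (i X).
  by exists X => //; apply: isomorphic_refl.
split.
- exact: ess_image_additive (cotorsion_subcatl cot).
- exact: ess_image_additive (cotorsion_subcatr cot).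
- exact: ess_image_summand (cotorsion_summandl cot).
- exact: ess_image_summand (cotorsion_summandr cot).
- exact: ess_image_extension (cotorsion_extl cot).
- exact: ess_image_extension (cotorsion_extr cot).
- by move=> X [A _ XA]; apply/im_ker; exists A.
- by move=> X [A _ XA]; apply/im_ker; exists A.
- move=> A B [A0 SA AA0] [B0 VB BB0].
  exact: ess_image_Ext1 (cotorsion_Ext1 cot SA VB).
- move=> X /im_ker[X0 [x [x' [x'x xx']]]].
  have [V0 [S0 [k [p [VV SS /(exact_short_exact exi) kp]]]]] :=
    cotorsion_resl cot X0.
  exists (i V0), (i S0), (fmap i k), (x' ∘ fmap i p).
  split; [exact: imP|exact: imP|].
  rewrite -[fmap i k]compm1 -[fmap i k]comp1m -[x' ∘ _]compm1.
  apply: short_exact_iso kp; rewrite ?comp1m //; last by exists x.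
  by exists (idm _); rewrite comp1m.
- move=> X /im_ker[X0 [x [x' [x'x xx']]]].
  have [V0 [S0 [j [c [VV SS /(exact_short_exact exi) jc]]]]] :=
    cotorsion_resr cot X0.
  exists (i V0), (i S0), (fmap i j ∘ x), (fmap i c).
  split; [exact: imP|exact: imP|].
  rewrite -[fmap i j]comp1m -[fmap i c]comp1m -[idm _ ∘ fmap i c]compm1.
  apply: short_exact_iso jc; rewrite ?comp1m //; first by exists x'.
  by exists (idm _); rewrite comp1m.
Qed.

End EssentialImage.

Theorem corollary2p26 (N C CN : category)
  (abN : abelian N) (abC : abelian C) (abCN : abelian CN)
  (rec : recollement N C CN)
  (smallC : skeletally_small C)
  (projC : enough_projectives C) (injC : enough_injectives C)
  (S V : N -> Prop) (cotSV : cotorsion_pair S V) :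
  let S' := ess_image (rec_i rec) S in
  let V' := ess_image (rec_i rec) V in
  (forall X Y : C, S' X -> V' Y -> Ext_zero 2 X Y) ->
  exists h : gHTCP S' (right_perp1 S') (left_perp1 V') V',
    induces_equivalence (rec_e rec) (meet_subcat (right_perp1 S') (left_perp1 V'))
      (gHTCP_ideal h).
Proof.
move=> S' V' ext2.
have exi := adjoint_triple_exact abN (rec_adj_qi rec) (rec_adj_ip rec).
have exe := adjoint_triple_exact abC (rec_adj_le rec) (rec_adj_er rec).
have cot := ess_image_relative_cotorsion_pair abN abC exi exe (rec_ff_i rec)
  (rec_im_ker rec) cotSV.
have env := envelope_exists abC exe (rec_adj_er rec) injC.
have coenv := coenvelope_exists abC exe (rec_adj_le rec) projC.
exists (gHTCP_perp abC cot env coenv projC ext2).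
exact: (localization_induces_equivalence abC exe (rec_adj_le rec) cot projC ext2 _ env
  (rec_ff_l rec)).
Qed.
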